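(* Let $\Phi=\{f_a(x)=r_aO_ax+t_a\}_{a\in\mathcal A}$ be a self-similar iterated function system acting on $\mathbb R^2$ such that $O_a\in SO(2)$ for all $a\in\mathcal A$, and such that there exist $a,b\in\mathcal A$ for which the pair $(\theta_a,\theta_b)$ is Diophantine. Then every self-similar measure for $\Phi$ has polylogarithmic Fourier decay.
   Context: Self-similar IFS on $\mathbb R^2$: a family $\{f_a(x)=r_aO_ax+t_a\}_{a\in\mathcal A}$ with $\mathcal A$ finite, $|r_a|\in(0,1)$, $O_a\in O(2)$, $t_a\in\mathbb R^2$. It is always assumed that the maps $f_a$ do not all share a common fixed point. For $O_a\in SO(2)$, $\theta_a\in[0,1)$ denotes the number such that $O_a$ is the anticlockwise rotation by angle $2\pi\theta_a$. A pair of real numbers $(\theta_1,\theta_2)$ is Diophantine if there exist $C,l>0$ such that for all $(p,q,r)\in\mathbb Z^3$ with $(p,q)\ne(0,0)$ one has $|p\theta_1+q\theta_2+r|\ge \dfrac{C}{\max\{|p|,|q|\}^{l}}$. Self-similar measure: given a probability vector $(p_a)_{a\in\mathcal A}$ with all $p_a>0$, the unique Borel probability measure $\mu$ on $\mathbb R^2$ with $\mu=\sum_{a\in\mathcal A}p_a\,f_a\mu$, where $f_a\mu$ is the pushforward. Fourier transform: $\widehat\mu(\xi)=\int e^{2\pi i\langle\xi,x\rangle}\,d\mu(x)$. Polylogarithmic Fourier decay: there is $\kappa>0$ with $|\widehat\mu(\xi)|=O((\log\|\xi\|)^{-\kappa})$ as $\|\xi\|\to\infty$. *)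

(* Defs.v *)
From mathcomp Require Import all_boot all_order all_algebra.
From mathcomp Require Import all_classical all_reals all_analysis.
From mathcomp Require Import complex.

Set Implicit Arguments.
Unset Strict Implicit.
Unset Printing Implicit Defensive.

Import Order.TTheory GRing.Theory Num.Theory.

Local Open Scope classical_set_scope.
Local Open Scope ring_scope.

(* The plane is the product type [R * R]: its product sigma-algebra is the
   Borel sigma-algebra of the plane.  Its canonical library norm is the sup
   norm, hence the explicit Euclidean structure. *)
Definition dotp (R : realType) (x y : R * R) : R := x.1 * y.1 + x.2 * y.2.

Definition enorm (R : realType) (x : R * R) : R := Num.sqrt (dotp x x).

Definition apply_mx (R : realType) (M : 'M[R]_2) (x : R * R) : R * R :=
  (M 0 0 * x.1 + M 0 1 * x.2, M 1 0 * x.1 + M 1 1 * x.2).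

Definition orthogonal_group (R : realType) : set 'M[R]_2 :=
  [set M | M *m M^T = 1%:M].

Definition special_orthogonal_group (R : realType) : set 'M[R]_2 :=
  [set M | orthogonal_group M /\ \det M = 1].

Definition rotation (R : realType) (phi : R) : 'M[R]_2 :=
  \matrix_(i, j)
    if i == j then cos phi else if i == 0 then - sin phi else sin phi.

(* Angles are measured in turns. *)
Definition rotation_angle (R : realType) (M : 'M[R]_2) (theta : R) : Prop :=
  0 <= theta < 1 /\ M = rotation (2 * pi * theta).

Definition affine_map (R : realType) (r : R) (M : 'M[R]_2) (t x : R * R) :
    R * R :=
  (r * (apply_mx M x).1 + t.1, r * (apply_mx M x).2 + t.2).

Record similarity_ifs (R : realType) (A : finType) := SimilarityIfs {
  ratio : A -> R;
  linear_part : A -> 'M[R]_2;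
  translation : A -> R * R;
  ratio_bounds : forall a, 0 < `|ratio a| < 1;
  linear_part_orthogonal : forall a, orthogonal_group (linear_part a);
  no_common_fixed_point :
    ~ exists x : R * R, forall a,
        affine_map (ratio a) (linear_part a) (translation a) x = x
}.

Definition ifs_map (R : realType) (A : finType) (Phi : similarity_ifs R A)
    (a : A) : R * R -> R * R :=
  affine_map (ratio Phi a) (linear_part Phi a) (translation Phi a).

Definition diophantine_pair (R : realType) (theta1 theta2 : R) : Prop :=
  exists C l : R, [/\ 0 < C, 0 < l &
    forall p q r : int, (p, q) <> (0, 0) ->
      C / ((Num.max `|p| `|q|)%:~R `^ l)
        <= `|p%:~R * theta1 + q%:~R * theta2 + r%:~R|].

Definition self_similar_measure (R : realType) (A : finType)
    (Phi : similarity_ifs R A) (mu : probability (R * R)%type R) : Prop :=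
  exists p : A -> R,
    [/\ forall a, 0 < p a,
        \sum_(a : A) p a = 1 &
        forall B : set (R * R), measurable B ->
          mu B = (\sum_(a : A) (p a)%:E * pushforward mu (ifs_map Phi a) B)%E].

(* Real and imaginary parts of the integral of exp (2 pi i <xi, x>). *)
Definition fourier (R : realType) (mu : probability (R * R)%type R)
    (xi : R * R) : R[i] :=
  Complex (\int[mu]_x cos (2 * pi * dotp xi x))
          (\int[mu]_x sin (2 * pi * dotp xi x)).

Definition polylog_fourier_decay (R : realType)
    (mu : probability (R * R)%type R) : Prop :=
  exists2 kappa : R, 0 < kappa &
    exists C M : R, forall xi : R * R, M <= enorm xi ->
      ComplexField.Normc.normc (fourier mu xi)
        <= C * (ln (enorm xi)) `^ (- kappa).

(* Main.v *)
Require Import Defs.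
From mathcomp Require Import all_boot all_order all_algebra.
From mathcomp Require Import all_classical all_reals all_analysis.
From mathcomp Require Import measurable_realfun complex ring lra zify.

(* Identify the plane with C, so that [f_a x = lam_a x + t_a], and write the
   Fourier transform as a function [F] of [z = xi.1 - i xi.2]; self-similarity
   reads [F z = \sum_a p_a e(re (z t_a)) F (lam_a z)], hence [G = |F|] is
   bounded by its averages along the walk [z -> lam_a z].

   Flattening.  If [f_x] and [f_y] have distinct fixed points, the words [x y]
   and [y x] have the same multiplier but different translations, which yields a
   cancellation factor [cos (pi re (z d))]; used twice in a row, with
   [lam_x lam_y] not real, it is close to [1] only for [z] near a lattice.  A
   point near the lattice after one step is determined up to [eta] by its
   lattice point, so passing to smaller scales does not increase the mass of
   balls, except on rare steps.  Hence [G ^ q], integrated against a measure on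
   the disc of radius [T] whose unit balls have mass at most [m], is
   [O(T ^ eps m)], for arbitrarily small [eps] and suitable [q].

   Spreading.  Grouping words as [a^(2l) c] and [a^(2l+1) c] ([c <> a]), and
   likewise for [b], bounds [G z] by an average of
   [G (lam_a^i lam_b^j k)] with [i], [j] independent binomial variables
   of size [n ~ sqrt (log |z|)].  Continuing every point with one common word
   until its modulus is at most [T], a power of [n], points stopped at the same
   time are separated because [(theta_a, theta_b)] is Diophantine, while only
   [n ^ (3/4)] stopping times matter.  So balls of the resulting measure have mass
   [n ^ (- 1/4)], which beats the loss [T ^ eps]. *)

Set Implicit Arguments.
Unset Strict Implicit.
Unset Printing Implicit Defensive.

Import Order.TTheory GRing.Theory Num.Theory.

Local Open Scope ring_scope.

(** * Elementary inequalities *)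

Lemma bernoulli_ineq (R : realFieldType) (n : nat) (x : R) :
  -1 <= x -> 1 + n%:R * x <= (1 + x) ^+ n.
Proof.
move=> hx; elim: n => [|n IH]; first by rewrite mul0r addr0 expr0.
have h : (1 + x) * (1 + n%:R * x) <= (1 + x) * (1 + x) ^+ n.
  by apply: ler_wpM2l IH; lra.
rewrite exprS; apply: le_trans h.
have : 0 <= n%:R * x ^+ 2 by rewrite mulr_ge0 ?sqr_ge0.
rewrite -natr1; nra.
Qed.

(** Since [(1 - x) (1 + x) <= 1], it suffices to invert Bernoulli's inequality for [- x]. *)
Lemma exprD1n_le (R : realFieldType) (n : nat) (x : R) :
  0 <= x -> n%:R * x < 1 -> (1 + x) ^+ n <= (1 - n%:R * x)^-1.
Proof.
move=> x0 hx.
case: n hx => [|n] hx; first by rewrite mul0r subr0 invr1 expr0.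
have x1 : x < 1.
  apply: le_lt_trans hx; rewrite -natr1 mulrDl mul1r lerDr.
  by rewrite mulr_ge0.
have h1 : 1 - n.+1%:R * x <= (1 - x) ^+ n.+1.
  have := @bernoulli_ineq R n.+1 (- x); rewrite mulrN; apply; lra.
have h2 : (1 - x) ^+ n.+1 * (1 + x) ^+ n.+1 <= 1.
  rewrite -exprMn; apply: exprn_ile1; nra.
rewrite -[X in _ <= X]mul1r ler_pdivlMr; last by rewrite subr_gt0.
apply: le_trans h2; rewrite mulrC; apply: ler_wpM2r h1.
by apply: exprn_ge0; lra.
Qed.

(** Convexity by induction: multiplying the tangent bound by [x] exceeds the next one by
    [(q + 1) m ^ q (x - m) ^ 2 >= 0]. *)
Lemma expr_tangent (R : realFieldType) (q : nat) (x m : R) :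
  0 <= x -> 0 <= m ->
  m ^+ q.+1 + q.+1%:R * m ^+ q * (x - m) <= x ^+ q.+1.
Proof.
move=> x0 m0; elim: q => [|q IH]; first by rewrite !expr1 expr0 mul1r; lra.
have h : x * (m ^+ q.+1 + q.+1%:R * m ^+ q * (x - m)) <= x * x ^+ q.+1.
  exact: ler_wpM2l.
rewrite [x ^+ q.+2]exprS; apply: le_trans h; rewrite -subr_ge0.
have -> : x * (m ^+ q.+1 + q.+1%:R * m ^+ q * (x - m)) -
  (m ^+ q.+2 + q.+2%:R * m ^+ q.+1 * (x - m)) =
  q.+1%:R * m ^+ q * (x - m) ^+ 2.
  by rewrite -[q.+2%:R]natr1 !exprS; ring.
by rewrite mulr_ge0 ?sqr_ge0 ?mulr_ge0 ?exprn_ge0.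
Qed.

(** Summing the tangent inequalities at the mean [m = t / s] cancels the linear terms. The weights
    are not normalised because sub-probability weights occur later, such as binomial weights cut to
    a window. *)
Lemma jensen_expr (R : realFieldType) (I : finType) (p x : I -> R) (q : nat) :
  (forall i, 0 <= p i) -> (forall i, 0 <= x i) ->
  (\sum_i p i * x i) ^+ q.+1
    <= (\sum_i p i) ^+ q * \sum_i p i * x i ^+ q.+1.
Proof.
move=> p0 x0; set s := \sum_i p i; set t := \sum_i p i * x i.
have s0 : 0 <= s by apply: sumr_ge0.
have t0 : 0 <= t by apply: sumr_ge0 => i _; rewrite mulr_ge0.
have [s00|sn0] := eqVneq s 0.
  have pz i : p i = 0.
    by apply/eqP; move/eqP: s00; rewrite psumr_eq0// => /allP/(_ i); rewrite mem_index_enum => /(_ isT).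
  have -> : t = 0 by rewrite /t big1// => i _; rewrite pz mul0r.
  rewrite expr0n/= mulr_ge0 ?exprn_ge0// sumr_ge0// => i _.
  by rewrite mulr_ge0 ?exprn_ge0.
have sp : 0 < s by rewrite lt_def sn0.
pose m := t / s.
have m0 : 0 <= m by rewrite divr_ge0.
have tE : t = m * s by rewrite /m divfK.
have h : s * m ^+ q.+1 <= \sum_i p i * x i ^+ q.+1.
  apply: (@le_trans _ _ (\sum_i p i * (m ^+ q.+1 + q.+1%:R * m ^+ q * (x i - m)))).
    have -> : \sum_i p i * (m ^+ q.+1 + q.+1%:R * m ^+ q * (x i - m)) =
       m ^+ q.+1 * s + q.+1%:R * m ^+ q * (t - m * s).
      rewrite /s /t !mulr_sumr -sumrB mulr_sumr -big_split/=.
      by apply: eq_bigr => i _; ring.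
    by rewrite tE subrr mulr0 addr0 mulrC.
  by apply: ler_sum => i _; apply: ler_wpM2l => //; exact: expr_tangent.
have -> : t ^+ q.+1 = s ^+ q * (s * m ^+ q.+1).
  by rewrite {1}tE exprMn mulrA -exprSr mulrC.
by apply: ler_wpM2l => //; rewrite exprn_ge0.
Qed.

(* Weights [1 - t] and [t] with [t] slightly above [e]: as [m] grows the
   leftover [y] is damped by [2 ^ s] while [x] pays almost nothing. *)
Lemma tilted_holder (R : realFieldType) (e x y : R) (s m q : nat) :
  q.+1 = (s * m)%N -> 0 < e -> 4 * e <= 1 -> 2 * e * s%:R < 1 ->
  0 <= x -> 0 <= y ->
  ((1 - e) * x + e * y) ^+ q.+1
    <= (1 - 2 * e * s%:R)^-1 * x ^+ q.+1 + (2 ^+ s)^-1 * y ^+ q.+1.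
Proof.
move=> qE e0 e4 es x0 y0.
have m0 : (0 < m)%N by case: m qE => //; rewrite muln0.
have m1 : 1 <= m%:R :> R by rewrite ler1n.
have im0 : 0 < (m%:R)^-1 :> R by rewrite invr_gt0 ltr0n.
have im1 : (m%:R)^-1 <= 1 :> R by rewrite invf_le1 // ltr0n.
(* Here [e / t = (1 + 1 / m)^-1], and [(1 + 1 / m) ^ m >= 2] makes its power of order [s m] at most
   [2 ^- s]; on the other side [(1 - e) / (1 - t) <= 1 + 2 e / m], whose power of order [s m] stays
   bounded. *)
pose t : R := e * (1 + m%:R^-1).
have t0 : 0 < t by rewrite mulr_gt0 // ltr_wpDr // ltW.
have t12 : t <= 2 * e by rewrite /t; nra.
have tlt : 0 < 1 - t by lra.
pose X := (1 - e) / (1 - t) * x; pose Y := e / t * y.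
have X0 : 0 <= X by rewrite mulr_ge0 ?divr_ge0 //; lra.
have Y0 : 0 <= Y by rewrite mulr_ge0 ?divr_ge0 //; lra.
pose pp (b : bool) : R := if b then 1 - t else t.
pose xx (b : bool) : R := if b then X else Y.
have := @jensen_expr R bool pp xx q; rewrite !big_bool/=.
have -> : 1 - t + t = 1 by ring.
rewrite expr1n mul1r.
have -> : (1 - t) * X + t * Y = (1 - e) * x + e * y.
  by rewrite /X /Y; field; rewrite !gt_eqF.
move=> H; have {}H := H _ _.
apply: (le_trans (H _ _)); first by case; rewrite /pp ltW.
  by case.
apply: lerD.
  apply: (@le_trans _ _ (X ^+ q.+1)); first by rewrite ler_piMl ?exprn_ge0//; lra.
  rewrite exprMn; apply: ler_wpM2r; first exact: exprn_ge0.
  have h : (1 - e) / (1 - t) <= 1 + 2 * e / m%:R.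
    rewrite ler_pdivrMr// /t; move: im0 im1; set c := m%:R^-1 => c0 c1.
    have : 0 <= e * c * (1 - 2 * (e * (1 + c))).
      by rewrite !mulr_ge0 ?(ltW e0) ?(ltW c0)//; nra.
    by move=> hw; rewrite -subr_ge0; apply: le_trans hw _; rewrite le_eqVlt; apply/orP; left; apply/eqP; ring.
  have em0 : 0 <= 2 * e / m%:R by rewrite divr_ge0 ?mulr_ge0//; lra.
  apply: (@le_trans _ _ ((1 + 2 * e / m%:R) ^+ q.+1)).
    by rewrite lerXn2r ?nnegrE//; [apply: divr_ge0; lra | lra].
  have em : q.+1%:R * (2 * e / m%:R) = 2 * e * s%:R.
    by rewrite qE natrM; field; rewrite pnatr_eq0 -lt0n.
  by rewrite -em; apply: exprD1n_le; rewrite ?em.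
rewrite /Y exprMn mulrA; apply: ler_wpM2r; first exact: exprn_ge0.
apply: (@le_trans _ _ ((e / t) ^+ q.+1)).
  by rewrite ler_piMl ?exprn_ge0 ?divr_ge0//; lra.
have -> : e / t = (1 + m%:R^-1)^-1.
  by rewrite /t invfM mulrA mulfV ?mul1r// gt_eqF.
rewrite exprVn lef_pV2 ?posrE ?exprn_gt0 ?ltr_wpDr ?(ltW im0)//.
rewrite qE mulnC exprM.
have h2 : 2 <= (1 + m%:R^-1) ^+ m :> R.
  have := @bernoulli_ineq R m (m%:R^-1).
  by rewrite mulfV ?pnatr_eq0 -?lt0n//; apply; lra.
by rewrite lerXn2r ?nnegrE// exprn_ge0//; lra.
Qed.

Lemma natr_bound (R : archiRealDomainType) (x : R) : exists n : nat, x <= n%:R.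
Proof.
exists (Num.bound `|x|); apply: ltW.
exact: le_lt_trans (ler_norm x) (archi_boundP (normr_ge0 x)).
Qed.

Lemma expr_small (R : archiRealFieldType) (x c : R) :
  0 <= x -> x < 1 -> 0 < c -> exists n : nat, x ^+ n <= c.
Proof.
move=> x0 x1 c0; have [->|xn0] := eqVneq x 0.
  by exists 1%N; rewrite expr1 ltW.
have xp : 0 < x by rewrite lt_def xn0.
have [n hn] := natr_bound (c^-1 / (x^-1 - 1)); exists n.
have ix : 0 < x^-1 - 1 by rewrite subr_gt0 invf_gt1.
rewrite -[c]invrK -[x]invrK exprVn lef_pV2 ?posrE ?exprn_gt0 ?invr_gt0//.
have := @bernoulli_ineq R n (x^-1 - 1).
rewrite addrCA subrr addr0 => h; apply: le_trans (h ltac:(lra)).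
by move: hn; rewrite ler_pdivrMr//; lra.
Qed.

Lemma expr_large (R : archiRealFieldType) (x c : R) :
  1 < x -> exists n : nat, c <= x ^+ n.
Proof.
move=> x1; have x0 : 0 < x by lra.
have [|||n hn] := @expr_small R x^-1 (Num.max c 1)^-1.
- by rewrite invr_ge0 ltW.
- by rewrite invf_lt1.
- by rewrite invr_gt0 lt_max ltr01 orbT.
exists n; move: hn; rewrite exprVn lef_pV2 ?posrE ?exprn_gt0 ?lt_max ?ltr01 ?orbT//.
by apply: le_trans; rewrite le_max lexx.
Qed.

Lemma natr_mul_expr_le (R : archiRealFieldType) (x : R) (m : nat) :
  0 < x -> x < 1 -> m%:R * x ^+ m <= (x^-1 - 1)^-1.
Proof.
move=> xp x1; have ix : 0 < x^-1 - 1 by rewrite subr_gt0 invf_gt1.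
have hm := @bernoulli_ineq R m (x^-1 - 1).
have {}hm : m%:R * (x^-1 - 1) <= (x ^+ m)^-1.
  by rewrite -exprVn; move: hm; rewrite addrCA subrr addr0 => /(_ ltac:(lra)); lra.
rewrite -[(x^-1 - 1)^-1]mul1r ler_pdivlMr// mulrAC.
by rewrite -ler_pdivlMr ?exprn_gt0// mul1r.
Qed.

Lemma expr_linear_small (R : archiRealFieldType) (x a b c : R) :
  0 <= x -> x < 1 -> 0 <= a -> 0 <= b -> 0 < c ->
  exists n : nat, (0 < n)%N /\ x ^+ n * (a * n%:R + b) <= c.
Proof.
move=> x0 x1 a0 b0 c0; have [->|xn0] := eqVneq x 0.
  by exists 1%N; rewrite expr1 mul0r; split=> //; apply: ltW.
have xp : 0 < x by rewrite lt_def xn0.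
have ix : 0 < x^-1 - 1 by rewrite subr_gt0 invf_gt1.
pose K := 2 * a / (x^-1 - 1) + b + 1.
have K0 : 0 < K.
  by rewrite /K ltr_wpDl ?addr_ge0 ?divr_ge0 ?mulr_ge0 ?(ltW ix)//.
have [n hn] := @expr_small R x (c / K) x0 x1 (divr_gt0 c0 K0).
have H m := natr_mul_expr_le m xp x1.
(* One half of the exponent is below [c / K], the other half absorbs the linear factor into [K]. *)
exists (n.+1 + n.+1)%N; split=> //.
have xn1 m : x ^+ m <= 1 by apply: exprn_ile1; lra.
have xS : x ^+ n.+1 <= c / K.
  by apply: le_trans hn; rewrite exprS ler_piMl ?exprn_ge0//; lra.
have xS0 : 0 <= x ^+ n.+1 by apply: exprn_ge0.
rewrite exprD natrD -mulrA; apply: (@le_trans _ _ (c / K * K)); last first.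
  by rewrite divfK// gt_eqF.
apply: ler_pM => //; first by rewrite mulr_ge0// addr_ge0// mulr_ge0// addr_ge0.
rewrite mulrDr mulrCA; have hb : x ^+ n.+1 * b <= b by rewrite ler_piMl.
have := H n.+1; set d := (x^-1 - 1)^-1 => hh.
have : a * (x ^+ n.+1 * n.+1%:R) <= a * d by rewrite [x ^+ _ * _]mulrC; apply: ler_wpM2l.
rewrite /K -/d mulrDr; set X := x ^+ n.+1 * n.+1%:R; nra.
Qed.

(** * Complex modulus and masses of balls *)

Local Notation normc := ComplexField.Normc.normc.
Local Notation re := complex.Re.
Local Notation im := complex.Im.

Lemma normc_ge0 (R : rcfType) (z : R[i]) : 0 <= normc z.
Proof. by case: z => a b; exact: sqrtr_ge0. Qed.

Lemma normcM (R : rcfType) (x y : R[i]) : normc (x * y) = normc x * normc y.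
Proof. exact: ComplexField.Normc.normcM. Qed.

Lemma normc0 (R : rcfType) : normc (0 : R[i]) = 0.
Proof. exact: ComplexField.Normc.normc0. Qed.

Lemma normc1 (R : rcfType) : normc (1 : R[i]) = 1.
Proof. exact: ComplexField.Normc.normc1. Qed.

Lemma normcX (R : rcfType) (x : R[i]) (n : nat) : normc (x ^+ n) = normc x ^+ n.
Proof. by elim: n => [|n IH]; rewrite ?expr0 ?normc1// !exprS normcM IH. Qed.

Lemma le_normcB (R : rcfType) (x y : R[i]) :
  normc (x - y) <= normc x + normc y.
Proof. by rewrite -[normc y]normcN; exact: le_normcD. Qed.

Lemma normc_gt0 (R : rcfType) (z : R[i]) : (0 < normc z) = (z != 0).
Proof.
rewrite lt_def normc_ge0 andbT; apply/idP/idP; apply: contra.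
  by move=> /eqP ->; rewrite normc0.
by move=> /eqP/ComplexField.Normc.eq0_normc ->.
Qed.

Lemma normc_sqr (R : rcfType) (z : R[i]) : normc z ^+ 2 = re z ^+ 2 + im z ^+ 2.
Proof. by case: z => a b /=; rewrite sqr_sqrtr// addr_ge0 ?sqr_ge0. Qed.

Lemma re_le_normc (R : rcfType) (z : R[i]) : `|re z| <= normc z.
Proof.
rewrite -[leRHS]ger0_norm ?normc_ge0// -ler_sqr ?nnegrE// !real_normK ?num_real//.
by rewrite normc_sqr lerDl sqr_ge0.
Qed.

Lemma im_le_normc (R : rcfType) (z : R[i]) : `|im z| <= normc z.
Proof.
rewrite -[leRHS]ger0_norm ?normc_ge0// -ler_sqr ?nnegrE// !real_normK ?num_real//.
by rewrite normc_sqr lerDr sqr_ge0.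
Qed.

Lemma normc_le_reim (R : rcfType) (z : R[i]) : normc z <= `|re z| + `|im z|.
Proof.
rewrite -ler_sqr ?nnegrE ?normc_ge0 ?addr_ge0// normc_sqr sqrrD.
by rewrite !real_normK ?num_real// addrAC lerDl mulrn_wge0 ?mulr_ge0.
Qed.

(** A finite measure is encoded by indexed weights and positions, so that points can be moved
    without merging those that coincide. *)
Definition ball_mass (R : realType) (I : finType) (W : I -> R) (Z : I -> R[i])
    (rho m : R) : Prop :=
  forall x : R[i], \sum_(i | normc (Z i - x) <= rho) W i <= m.

Lemma ler_sum_subset (R : numDomainType) (I : finType) (P Q : pred I) (W : I -> R) :
  (forall i, 0 <= W i) -> (forall i, P i -> Q i) ->
  \sum_(i | P i) W i <= \sum_(i | Q i) W i.
Proof.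
move=> W0 PQ; rewrite big_mkcond [leRHS]big_mkcond/=; apply: ler_sum => i _.
by case: ifP => [/PQ ->//|_]; case: ifP.
Qed.

(** The square of half-side [R'] is cut into cells of side [rho / 2]; a point and the corner [c] of
    its cell differ by at most [rho / 2] in each coordinate. The number of cells depends on the
    radii only, not on the measure. *)
Lemma ball_mass_covering (R : realType) (rho R' : R) : 0 < rho -> 0 <= R' ->
  exists K : nat, (0 < K)%N /\ forall (I : finType) (W : I -> R) (Z : I -> R[i]) (m : R),
    (forall i, 0 <= W i) -> 0 <= m ->
    ball_mass W Z rho m -> ball_mass W Z R' (K%:R * m).
Proof.
move=> rho0 R'0; pose h := rho / 2.
have h0 : 0 < h by rewrite /h; lra.
have [N hN] := natr_bound (2 * R' / h).
exists (N.+1 * N.+1)%N; split => // I W Z m W0 m0 Wm x.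
pose u (s : R) : nat := Num.truncn ((s + R') / h).
pose p (i : I) : 'I_N.+1 * 'I_N.+1 := (inord (u (re (Z i - x))), inord (u (im (Z i - x)))).
rewrite (partition_big p xpredT)//=.
apply: (@le_trans _ _ (\sum_(j : 'I_N.+1 * 'I_N.+1) m)); last first.
  by rewrite sumr_const card_prod card_ord mulr_natl.
have key (s : R) : `|s| <= R' ->
   `|s - (((inord (u s) : 'I_N.+1) : nat)%:R * h - R')| <= h.
  move=> sR; have /andP[s1 s2] : - R' <= s <= R' by rewrite -ler_norml.
  have hs : 0 <= (s + R') / h by rewrite divr_ge0 ?(ltW h0)//; lra.
  have /andP[a1 a2] := truncn_itv hs.
  have uN : (u s < N.+1)%N.
    rewrite ltnS -(ler_nat R); apply: le_trans a1 _; apply: le_trans hN.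
    by rewrite ler_pM2r ?invr_gt0//; lra.
  rewrite inordK//; move: a1 a2; rewrite -/(u s); rewrite ler_pdivlMr// ltr_pdivrMr// => a1 a2.
  rewrite ler_norml; rewrite -natr1 in a2; nra.
apply: ler_sum => -[a b] _.
pose c : R[i] := x + Complex ((a : nat)%:R * h - R') ((b : nat)%:R * h - R').
apply: le_trans (Wm c); apply: ler_sum_subset => // i /andP[iR /eqP[pa pb]].
have hr := le_trans (re_le_normc _) iR.
have hi := le_trans (im_le_normc _) iR.
apply: le_trans (normc_le_reim _) _.
have := key _ hr; have := key _ hi; rewrite /= pa pb /c.
case: (Z i) => za zb; case: (x) => xa xb /=.
rewrite !opprD !addrA => k1 k2.
rewrite (_ : rho = h + h); last by rewrite /h; field.
apply: lerD; [move: k2 | move: k1]; rewrite !opprK => kk; apply: le_trans kk.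
all: by rewrite le_eqVlt; apply/orP; left; apply/eqP; congr (`| _ |); ring.
Qed.

Lemma ball_mass_scale (R : realType) (I : finType) (W : I -> R) (Z : I -> R[i])
    (k : R[i]) (rho m : R) : k != 0 ->
  ball_mass W (fun i => k * Z i) rho m <-> ball_mass W Z (rho / normc k) m.
Proof.
move=> k0; have nk : 0 < normc k by rewrite normc_gt0.
have E z x : (normc (k * z - x) <= rho) = (normc (z - x / k) <= rho / normc k).
  rewrite ler_pdivlMr// -normcM mulrBl divfK// [z * k]mulrC.
  by [].
split => H x; last by under eq_bigl do rewrite E; exact: H.
by have := H (x * k); under eq_bigl do rewrite E mulfK//.
Qed.

(** Each enlargement by [1 / r] is performed after rescaling to radius [rho], so one covering number
    [K] serves at every step and the loss is only exponential in [l]. *)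
Lemma ball_mass_covering_iter (R : realType) (rho r : R) : 0 < rho -> 0 < r ->
  exists K : nat, (0 < K)%N /\ forall (l : nat) (I : finType) (W : I -> R) (Z : I -> R[i]) (m : R),
    (forall i, 0 <= W i) -> 0 <= m ->
    ball_mass W Z rho m -> ball_mass W Z (rho / r ^+ l) (K%:R ^+ l * m).
Proof.
move=> rho0 r0; have [||K [K0 HK]] := @ball_mass_covering R rho (rho / r) => //.
  by rewrite divr_ge0// ltW.
exists K; split=> //; elim => [|l IH] I W Z m W0 m0 Wm.
  by rewrite !expr0 mul1r divr1.
pose k : R[i] := Complex (r ^+ l) 0.
have nk : normc k = r ^+ l.
  by rewrite /k /= expr0n addr0 sqrtr_sqr ger0_norm// exprn_ge0// ltW.
have k0 : k != 0 by rewrite -normc_gt0 nk exprn_gt0.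
have := IH _ _ _ _ W0 m0 Wm; rewrite -nk => /(ball_mass_scale _ _ _ _ k0).
move=> /HK H; have {}H := H W0 _; rewrite [K%:R ^+ _]exprS -mulrA.
have := H (mulr_ge0 (exprn_ge0 _ (ler0n _ _)) m0) => /(ball_mass_scale _ _ _ _ k0).
by rewrite nk [r ^+ l.+1]exprS invfM !mulrA.
Qed.

(** * Flattening *)

Definition avg (R : realType) (B : finType) (p : B -> R) (lam : B -> R[i])
    (f : R[i] -> R) (z : R[i]) : R :=
  \sum_b p b * f (lam b * z).

Lemma iter_avg_ge0 (R : realType) (B : finType) (p : B -> R) (lam : B -> R[i])
    (f : R[i] -> R) (l : nat) (z : R[i]) :
  (forall b, 0 <= p b) -> (forall z, 0 <= f z) -> 0 <= iter l (avg p lam) f z.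
Proof.
move=> p0 f0; elim: l z => [|l IH] z //=.
by apply: sumr_ge0 => b _; rewrite mulr_ge0.
Qed.

Lemma iter_avg_le (R : realType) (B : finType) (p : B -> R) (lam : B -> R[i])
    (f g : R[i] -> R) (l : nat) (z : R[i]) :
  (forall b, 0 <= p b) -> (forall z, f z <= g z) ->
  iter l (avg p lam) f z <= iter l (avg p lam) g z.
Proof.
move=> p0 fg; elim: l z => [|l IH] z //=.
by apply: ler_sum => b _; rewrite ler_wpM2l.
Qed.

Lemma iter_avgD (R : realType) (B : finType) (p : B -> R) (lam : B -> R[i])
    (f g : R[i] -> R) (l : nat) (z : R[i]) :
  iter l (avg p lam) (fun z => f z + g z) z =
  iter l (avg p lam) f z + iter l (avg p lam) g z.
Proof.
elim: l z => [|l IH] z //=; rewrite -big_split/=.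
by apply: eq_bigr => b _; rewrite IH mulrDr.
Qed.

Lemma iter_avgZ (R : realType) (B : finType) (p : B -> R) (lam : B -> R[i])
    (f : R[i] -> R) (c : R) (l : nat) (z : R[i]) :
  iter l (avg p lam) (fun z => c * f z) z = c * iter l (avg p lam) f z.
Proof.
elim: l z => [|l IH] z //=; rewrite mulr_sumr.
by apply: eq_bigr => b _; rewrite IH mulrCA.
Qed.

Lemma iter_avg_unroll (R : realType) (B : finType) (p : B -> R) (lam : B -> R[i])
    (f h : R[i] -> R) (L : nat) (z : R[i]) :
  (forall b, 0 <= p b) -> (forall z, f z <= h z + avg p lam f z) ->
  f z <= \sum_(l < L) iter l (avg p lam) h z + iter L (avg p lam) f z.
Proof.
move=> p0 fh; elim: L => [|L IH]; first by rewrite big_ord0 add0r.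
apply: le_trans IH _; rewrite big_ord_recr/= -addrA lerD2l.
apply: le_trans (iter_avg_le lam L z p0 fh) _.
by rewrite iter_avgD -iterSr.
Qed.

Lemma iter_avg_expr (R : realType) (B : finType) (p : B -> R) (lam : B -> R[i])
    (f : R[i] -> R) (l q : nat) (z : R[i]) :
  (forall b, 0 <= p b) -> (forall z, 0 <= f z) ->
  iter l (avg p lam) f z ^+ q.+1 <=
  (\sum_b p b) ^+ l ^+ q * iter l (avg p lam) (fun z => f z ^+ q.+1) z.
Proof.
move=> p0 f0; elim: l z => [|l IH] z; first by rewrite expr0 expr1n mul1r.
have s0 : 0 <= \sum_b p b by apply: sumr_ge0.
rewrite /= /avg.
apply: (le_trans (jensen_expr _ p0 _)).
  by move=> b; apply: iter_avg_ge0.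
rewrite exprS exprMn -mulrA; apply: ler_wpM2l; first by rewrite exprn_ge0.
rewrite mulr_sumr; apply: ler_sum => b _; rewrite mulrCA.
by apply: ler_wpM2l.
Qed.

(** A word of length [l] multiplies all the points by the same [k], so a bound uniform over the
    possible moduli of [k] passes to the average. *)
Lemma sum_iter_avg_le (R : realType) (B : finType) (p : B -> R) (lam : B -> R[i])
    (r0 r1 : R) (I : finType) (W : I -> R) (Z : I -> R[i])
    (f : R[i] -> R) (s : R) (l : nat) :
  0 <= r0 -> (forall b, 0 <= p b) -> (forall b, r0 <= normc (lam b) <= r1) ->
  (forall k : R[i], r0 ^+ l <= normc k <= r1 ^+ l ->
     \sum_i W i * f (k * Z i) <= s) ->
  \sum_i W i * iter l (avg p lam) f (Z i) <= (\sum_b p b) ^+ l * s.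
Proof.
move=> r00 p0 lr; elim: l Z => [|l IH] Z Hs.
  rewrite expr0 mul1r /=; have := Hs 1; rewrite normc1 !expr0 lexx => /(_ isT).
  by congr (_ <= _); apply: eq_bigr => i _; rewrite mul1r.
have -> : \sum_i W i * iter l.+1 (avg p lam) f (Z i) =
    \sum_b p b * \sum_i W i * iter l (avg p lam) f (lam b * Z i).
  under eq_bigr => i _ do rewrite /= /avg mulr_sumr.
  rewrite exchange_big/=; apply: eq_bigr => b _.
  by rewrite mulr_sumr; apply: eq_bigr => i _; rewrite mulrCA.
rewrite exprS -mulrA mulr_suml; apply: ler_sum => b _.
apply: ler_wpM2l => //; apply: IH => k /andP[k0 k1].
under eq_bigr do rewrite mulrA; apply: Hs.
have /andP[b0 b1] := lr b.
by rewrite normcM !exprSr !ler_pM ?exprn_ge0 ?normc_ge0.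
Qed.

(* [g] and the letter [kap], of weight [P], carry the cancellation; the
   remaining letters form [B]. *)
Definition gain_recursion (R : realType) (B : finType) (P : R) (g : R[i] -> R)
    (kap : R[i]) (p : B -> R) (lam : B -> R[i]) (G : R[i] -> R) : Prop :=
  forall z, G z <= P * (g z * G (kap * z)) + avg p lam G z.

(** Decomposition by the first occurrence of [kap]: at step [l < L], with weight [P (1 - P) ^ l], or
    not before [L], with weight [e]. The two parts are normalised to [x] and [y], combined by
    [tilted_holder], and Jensen's inequality moves the power inside the averages. *)
Lemma sum_gain_expr_le (R : realType) (B : finType) (P : R) (g : R[i] -> R)
    (kap : R[i]) (p : B -> R) (lam : B -> R[i]) (G : R[i] -> R)
    (r0 r1 : R) (I : finType) (W : I -> R) (Z : I -> R[i])
    (L s m q : nat) (e s1 s2 : R) :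
  gain_recursion P g kap p lam G ->
  0 < P -> P < 1 -> (forall b, 0 <= p b) -> P + \sum_b p b = 1 ->
  (forall z, 0 <= g z) -> (forall z, 0 <= G z) ->
  0 <= r0 -> r1 <= 1 -> (forall b, r0 <= normc (lam b) <= r1) ->
  e = (1 - P) ^+ L -> q.+1 = (s * m)%N -> 4 * e <= 1 -> 2 * e * s%:R < 1 ->
  (forall i, 0 <= W i) ->
  (forall k : R[i], r0 ^+ L <= normc k <= 1 ->
    \sum_i W i * (g (k * Z i) * G (kap * (k * Z i))) ^+ q.+1 <= s1) ->
  (forall k : R[i], r0 ^+ L <= normc k <= r1 ^+ L ->
    \sum_i W i * G (k * Z i) ^+ q.+1 <= s2) ->
  \sum_i W i * G (Z i) ^+ q.+1 <=
    (1 - 2 * e * s%:R)^-1 * s1 + (2 ^+ s)^-1 * s2.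
Proof.
move=> rec P0 P1 p0 pE g0 G0 r00 r11 lr eE qE e4 es W0 H1 H2.
have eps0 : 0 < 1 - P by lra.
have sp : \sum_b p b = 1 - P by lra.
have e0 : 0 < e by rewrite eE exprn_gt0.
have e1 : 0 < 1 - e by lra.
pose A := avg p lam.
pose f z := g z * G (kap * z).
have f0 z : 0 <= f z by rewrite mulr_ge0.
pose x z := (1 - e)^-1 * \sum_(l < L) P * iter l A f z.
pose y z := e^-1 * iter L A G z.
have x0 z : 0 <= x z.
  rewrite mulr_ge0 ?invr_ge0 ?(ltW e1)// sumr_ge0// => l _.
  by rewrite mulr_ge0 ?(ltW P0)// iter_avg_ge0.
have y0 z : 0 <= y z.
  by rewrite mulr_ge0 ?invr_ge0 ?(ltW e0)// iter_avg_ge0.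
have Gxy z : G z <= (1 - e) * x z + e * y z.
  rewrite /x /y !mulrA !mulfV ?gt_eqF// !mul1r.
  have := @iter_avg_unroll R B p lam G (fun z => P * f z) L z p0 rec.
  by under eq_bigr do rewrite iter_avgZ.
have Pw : \sum_(l < L) P * (1 - P) ^+ l = 1 - e.
  rewrite -mulr_sumr eE.
  have := subrX1 (1 - P) L; rewrite (_ : 1 - P - 1 = - P); last by ring.
  by rewrite mulNr => h; rewrite -[RHS]opprB h opprK.
have xq z : x z ^+ q.+1 <=
    (1 - e)^-1 * \sum_(l < L) P * iter l A (fun z => f z ^+ q.+1) z.
  (* Dividing the [l]-step average by its mass [(1 - P) ^ l] exposes the weights [P (1 - P) ^ l], of
     total mass [1 - e], for Jensen's inequality. *)
  have E : \sum_(l < L) P * iter l A f z =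
      \sum_(l < L) P * (1 - P) ^+ l * (iter l A f z / (1 - P) ^+ l).
    apply: eq_bigr => l _; field.
    by rewrite expf_neq0// gt_eqF.
  rewrite /x exprMn E.
  apply: (@le_trans _ _ ((1 - e)^-1 ^+ q.+1 * ((1 - e) ^+ q *
     \sum_(l < L) P * iter l A (fun z => f z ^+ q.+1) z))).
    apply: ler_wpM2l; first by rewrite exprn_ge0// invr_ge0 ltW.
    apply: (le_trans (jensen_expr _ _ _)).
    - by move=> l; rewrite mulr_ge0 ?exprn_ge0// ltW.
    - move=> l; rewrite divr_ge0 ?exprn_ge0 ?(ltW eps0)//.
      by rewrite iter_avg_ge0.
    rewrite Pw; apply: ler_wpM2l; first by rewrite exprn_ge0// ltW.
    apply: ler_sum => l _; rewrite -mulrA; apply: ler_wpM2l; first exact: ltW.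
    rewrite exprMn exprVn mulrA -ler_pdivlMr ?invr_gt0 ?exprn_gt0//.
    rewrite invrK.
    have := @iter_avg_expr R B p lam f l q z p0 f0; rewrite sp => h.
    rewrite -ler_pdivlMl ?exprn_gt0//.
    apply: (le_trans h); rewrite le_eqVlt; apply/orP; left; apply/eqP.
    rewrite [(1 - P) ^+ l ^+ q.+1]exprS; field.
    by rewrite expf_neq0// gt_eqF.
  have E2 : (1 - e)^-1 ^+ q.+1 * (1 - e) ^+ q = (1 - e)^-1.
    by rewrite exprS -mulrA -exprMn mulVf ?gt_eqF// expr1n mulr1.
  by rewrite mulrA E2.
have yq z : y z ^+ q.+1 <= e^-1 * iter L A (fun z => G z ^+ q.+1) z.
  have := @iter_avg_expr R B p lam G L q z p0 G0; rewrite sp -eE => h.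
  rewrite /y exprMn exprVn -ler_pdivlMl ?invr_gt0 ?exprn_gt0// invrK.
  apply: (le_trans h); rewrite mulrA exprSr -[_ * e / e]mulrA mulfV ?gt_eqF// mulr1.
  exact: lexx.
have pt z : G z ^+ q.+1 <=
    (1 - 2 * e * s%:R)^-1 *
      ((1 - e)^-1 * \sum_(l < L) P * iter l A (fun z => f z ^+ q.+1) z) +
    (2 ^+ s)^-1 * (e^-1 * iter L A (fun z => G z ^+ q.+1) z).
  apply: (@le_trans _ _ (((1 - e) * x z + e * y z) ^+ q.+1)).
    by apply: lerXn2r; rewrite ?nnegrE// addr_ge0// mulr_ge0// ltW.
  apply: (le_trans (tilted_holder qE e0 e4 es (x0 z) (y0 z))).
  apply: lerD.
    by apply: ler_wpM2l (xq z); rewrite invr_ge0; lra.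
  by apply: ler_wpM2l (yq z); rewrite invr_ge0 exprn_ge0.
have W1 l : (l < L)%N -> \sum_i W i * iter l A (fun z => f z ^+ q.+1) (Z i)
    <= (1 - P) ^+ l * s1.
  move=> lL; rewrite -sp; apply: (@sum_iter_avg_le _ _ _ _ r0 r1) => // k /andP[k0 k1].
  apply: H1; apply/andP; split.
    apply: le_trans k0; apply: ler_wiXn2l => //; last exact: ltnW.
    (* Any letter of [B] gives [r0 <= r1 <= 1]; [B] is not empty, since its weights sum to
       [1 - P > 0]. *)
    case: (pickP (fun b : B => true)) => [b _|B0].
      have /andP[+ _] := lr b; move=> h0; apply: (le_trans h0).
      by have /andP[_ /le_trans->] := lr b.
    have : \sum_b p b = 0 by rewrite big_pred0.
    by lra.
  apply: (le_trans k1); apply: exprn_ile1 => //.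
  case: (pickP (fun b : B => true)) => [b _|B0].
    have /andP[h0 h1] := lr b; exact: le_trans (le_trans r00 h0) h1.
  have : \sum_b p b = 0 by rewrite big_pred0.
  by lra.
have W2 : \sum_i W i * iter L A (fun z => G z ^+ q.+1) (Z i) <= e * s2.
  by rewrite eE -sp; apply: (@sum_iter_avg_le _ _ _ _ r0 r1).
apply: (@le_trans _ _ (\sum_i W i * ((1 - 2 * e * s%:R)^-1 *
      ((1 - e)^-1 * \sum_(l < L) P * iter l A (fun z => f z ^+ q.+1) (Z i)) +
    (2 ^+ s)^-1 * (e^-1 * iter L A (fun z => G z ^+ q.+1) (Z i))))).
  by apply: ler_sum => i _; apply: ler_wpM2l.
under eq_bigr do rewrite mulrDr.
rewrite big_split/=; apply: lerD.
  under eq_bigr do rewrite mulrCA.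
  rewrite -mulr_sumr; apply: ler_wpM2l; first by rewrite invr_ge0; lra.
  under eq_bigr do rewrite mulrCA.
  rewrite -mulr_sumr ler_pdivrMl//.
  under eq_bigr do rewrite mulr_sumr.
  rewrite exchange_big/= -Pw mulr_suml; apply: ler_sum => l _.
  under eq_bigr do rewrite mulrCA.
  rewrite -mulr_sumr -mulrA; apply: ler_wpM2l; first exact: ltW.
  exact: W1.
under eq_bigr do rewrite mulrCA.
rewrite -mulr_sumr; apply: ler_wpM2l; first by rewrite invr_ge0 exprn_ge0.
under eq_bigr do rewrite mulrCA.
by rewrite -mulr_sumr ler_pdivrMl.
Qed.

Lemma ball_mass_le_radius (R : realType) (I : finType) (W : I -> R)
    (Z : I -> R[i]) (rho rho' m : R) :
  (forall i, 0 <= W i) -> rho <= rho' -> ball_mass W Z rho' m -> ball_mass W Z rho m.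
Proof.
move=> W0 le H x; apply: le_trans (H x); apply: ler_sum_subset => // i h.
exact: le_trans h le.
Qed.

(* Points where [g] is close to [1] are rigid: at distance at most [delta]
   they are in fact arbitrarily close. *)
Definition rigid_gain (R : realType) (g : R[i] -> R) : Prop :=
  exists2 delta : R, 0 < delta & forall eta : R, 0 < eta ->
    exists gam : R, [/\ 0 <= gam, gam < 1 & forall z z' : R[i],
      gam < g z -> gam < g z' -> normc (z - z') <= delta ->
      normc (z - z') <= eta].

(** Two good points whose images share a ball of radius [rho] satisfy
    [normc (k * Z i - k * Z i0) <= delta], hence [<= eta] by rigidity, and so [Z i] and [Z i0] are
    within [rho]. A ball of the image thus comes from a single ball of the original measure. *)
Lemma ball_mass_rigid (R : realType) (g : R[i] -> R) (kap k : R[i])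
    (r0 delta gam eta rho m : R) (I : finType) (W : I -> R) (Z : I -> R[i]) :
  0 < r0 -> r0 <= normc kap -> 2 * rho <= delta * r0 ->
  eta <= rho * normc k -> k != 0 -> 0 <= m -> (forall i, 0 <= W i) ->
  (forall z z' : R[i], gam < g z -> gam < g z' -> normc (z - z') <= delta ->
      normc (z - z') <= eta) ->
  ball_mass W Z rho m ->
  ball_mass (fun i => if gam < g (k * Z i) then W i else 0)
    (fun i => kap * (k * Z i)) rho m.
Proof.
move=> r00 rk rd er k0 m0 W0 Hg Wm x; rewrite -big_mkcondr/=.
pose Q i := (normc (kap * (k * Z i) - x) <= rho) && (gam < g (k * Z i)).
have nk0 : 0 < normc k by rewrite normc_gt0.
case: (pickP Q) => [i0 /andP[n0 g0]|Q0]; last by rewrite big_pred0.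
apply: le_trans (Wm (Z i0)); apply: ler_sum_subset => // i /andP[ni gi].
have h1 : normc (kap * (k * Z i) - kap * (k * Z i0)) <= delta * r0.
  have -> : kap * (k * Z i) - kap * (k * Z i0) =
     (kap * (k * Z i) - x) - (kap * (k * Z i0) - x) by ring.
  by apply: le_trans (le_normcB _ _) _; lra.
rewrite -mulrBr normcM in h1.
have h2 : normc (k * Z i - k * Z i0) <= delta.
  rewrite -(ler_pM2l (lt_le_trans r00 rk)); apply: (le_trans h1).
  rewrite mulrC; apply: ler_wpM2r => //; have := normc_ge0 (k * Z i - k * Z i0).
  have : 0 <= normc kap * normc (k * Z i - k * Z i0) by rewrite mulr_ge0 ?normc_ge0.
  by move=> a _; have := le_trans a h1; rewrite pmulr_lge0.
have := Hg _ _ gi g0 h2; rewrite -mulrBr normcM mulrC => h3.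
by rewrite -(ler_pM2r nk0); apply: le_trans er.
Qed.

(* [G] is small, in the sense of an arbitrarily small power of the scale,
   against every measure whose mass at a fixed scale [rho] is well spread. *)
Definition flat (R : realType) (r : R) (G : R[i] -> R) : Prop :=
  exists2 rho : R, 0 < rho & forall E : R, 1 < E ->
  exists (q : nat) (C : R), 0 <= C /\
    forall (k : nat) (I : finType) (W : I -> R) (Z : I -> R[i]) (m : R),
    (forall i, 0 <= W i) -> 0 <= m -> (forall i, normc (Z i) <= (r ^+ k)^-1) ->
    ball_mass W Z rho m ->
    \sum_i W i * G (Z i) ^+ q.+1 <= C * E ^+ k * m.

(** Induction on the scale, with [S] the bound at the previous scale. Points with [gam < g] keep the
    mass bound [M] and contribute [S]. The others, like the remainder after [L] steps, only satisfy
    the covering bound [KL * M], but carry the factor [gam ^ q.+1], respectively [2 ^- s], which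
    makes up for [KL]. *)
Theorem gain_recursion_flat (R : realType) (B : finType) (P : R) (g : R[i] -> R)
    (kap : R[i]) (p : B -> R) (lam : B -> R[i]) (G : R[i] -> R) (r0 r1 : R) :
  gain_recursion P g kap p lam G ->
  0 < P -> P < 1 -> (forall b, 0 <= p b) -> P + \sum_b p b = 1 ->
  (forall z, 0 <= g z <= 1) -> (forall z, 0 <= G z <= 1) ->
  0 < r0 -> r1 < 1 -> r0 <= normc kap <= r1 ->
  (forall b, r0 <= normc (lam b) <= r1) -> rigid_gain g ->
  flat r1 G.
Proof.
move=> rec P0 P1 p0 pE g01 G01 r00 r11 /andP[rk0 rk1] lr [delta d0 Hg].
have g0 z : 0 <= g z by have /andP[] := g01 z.
have g1 z : g z <= 1 by have /andP[] := g01 z.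
have G0 z : 0 <= G z by have /andP[] := G01 z.
have G1 z : G z <= 1 by have /andP[] := G01 z.
have r1p : 0 < r1 by apply: lt_le_trans r00 (le_trans rk0 rk1).
have r01 : r0 <= 1 by apply: le_trans (le_trans rk0 rk1) (ltW r11).
pose rho := delta * r0 / 2.
have rho0 : 0 < rho by rewrite /rho divr_gt0// mulr_gt0.
exists rho => // E E1.
have [K [K0 HK]] := ball_mass_covering_iter rho0 r00.
have [K' [K'0 HK']] := ball_mass_covering rho0 (@ler01 R).
pose e2 := Num.min (E - 1) 1.
have e20 : 0 < e2 by rewrite lt_min ltr01 andbT; lra.
have e2E : e2 <= E - 1 by rewrite ge_min lexx.
have e21 : e2 <= 1 by rewrite ge_min lexx orbT.
have [s2 hs2] := @expr_large R 2 (4 / e2) ltac:(lra).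
(* Order of the constants: [L] makes [e * s] small although [s] grows linearly in [L]; [2 ^ s] then
   dominates [KL = K ^ (L + 1)]; [eta] and [gam] depend on [L]; last comes [q + 1], a multiple of
   [s] so large that [gam ^ q.+1 * KL] is small. *)
have [|||||L [L0 hL]] := @expr_linear_small R (1 - P) K%:R (K + s2.+1)%:R (e2 / 16); try by [lra | rewrite ?divr_gt0].
pose s := (K * L.+1 + s2.+1)%N.
have sR : s%:R = K%:R * L%:R + (K + s2.+1)%:R :> R.
  by rewrite /s mulnS -!natrM -!natrD; congr (_%:R); ring.
pose e := (1 - P) ^+ L.
have e0 : 0 < e by rewrite exprn_gt0//; lra.
have es16 : e * s%:R <= e2 / 16 by rewrite sR.
have s1 : 1 <= s%:R :> R by rewrite ler1n /s addnS.
have e16 : e <= e2 / 16 by apply: le_trans es16; rewrite ler_peMr// ltW.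
pose KL : R := K%:R ^+ L.+1.
have KL0 : 0 < KL by rewrite exprn_gt0// ltr0n.
have hKs : (2 ^+ s)^-1 * KL <= e2 / 4.
  rewrite ler_pdivrMl ?exprn_gt0// exprD exprM /KL.
  apply: (@le_trans _ _ ((2 ^+ K) ^+ L.+1 * 1)).
    rewrite mulr1; apply: lerXn2r; rewrite ?nnegrE ?exprn_ge0//.
    by rewrite -natrX ler_nat ltnW// ltn_expl.
  rewrite -mulrA; apply: ler_wpM2l; first by rewrite !exprn_ge0.
  rewrite exprS; have h4 : 4 / e2 * (e2 / 4) = 1 by field; rewrite gt_eqF.
  have : 4 / e2 * (e2 / 4) <= 2 ^+ s2 * (e2 / 4).
    by apply: ler_wpM2r => //; rewrite divr_ge0 ?ltW.
  have : 0 <= 2 ^+ s2 * (e2 / 4) by rewrite mulr_ge0 ?exprn_ge0 ?divr_ge0 ?ltW.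
  by rewrite h4 -mulrA; lra.
pose eta := rho * r0 ^+ L.
have eta0 : 0 < eta by rewrite mulr_gt0// exprn_gt0.
have [gam [gam0 gam1 Hgam]] := Hg eta eta0.
have [m hm] := @expr_small R gam (e2 / 4 / KL) gam0 gam1 ltac:(by rewrite !divr_gt0).
pose q := (s * m.+1).-1.
have qE : q.+1 = (s * m.+1)%N.
  by rewrite /q prednK// muln_gt0 /s addnS.
have hgam : gam ^+ q.+1 * KL <= e2 / 4.
  rewrite -ler_pdivlMr//; apply: le_trans hm; apply: ler_wiXn2l => //; first exact: ltW.
  by rewrite qE (leq_trans (leqnSn m))// leq_pmull// /s addnS.
have es1 : 2 * e * s%:R < 1 by rewrite -mulrA; lra.
have Ales : (1 - 2 * e * s%:R)^-1 <= 1 + e2 / 4.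
  rewrite -[leLHS]mul1r ler_pdivrMr; last by lra.
  rewrite -mulrA; set t := e * s%:R in es16 *.
  have : 0 <= t by rewrite mulr_ge0// ltW.
  by nra.
(* At scale [0] all points lie in the unit disc, which is covered by [K'] balls of radius [rho], and
   [G <= 1]. *)
exists q, K'%:R; split => // k; elim: k => [|k IH] I W Z M W0 M0 Zk WM.
  rewrite expr0 mulr1.
  have := HK' _ _ _ _ W0 M0 WM 0; apply: le_trans.
  rewrite [leRHS]big_mkcond/=; apply: ler_sum => i _.
  have := Zk i; rewrite expr0 invr1 subr0 => ->.
  by rewrite ler_piMr// exprn_ile1.
set S := K'%:R * E ^+ k * M.
have S0 : 0 <= S by rewrite !mulr_ge0// exprn_ge0//; lra.
have HKL : ball_mass W Z (rho / r0 ^+ L.+1) (KL * M) by apply: HK.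
have kfar (k' : R[i]) : k' != 0 -> r0 ^+ L.+1 <= normc k' ->
    ball_mass W (fun i => k' * Z i) rho (KL * M).
  move=> k'0 hk'; apply/ball_mass_scale => //; apply: ball_mass_le_radius HKL => //.
  rewrite ler_pM2l// lef_pV2// ?posrE ?exprn_gt0//.
  by rewrite normc_gt0.
have SKL : K'%:R * E ^+ k * (KL * M) = KL * S by rewrite /S; ring.
have Zr (c : R) : c <= r1 -> forall i, c * normc (Z i) <= (r1 ^+ k)^-1.
  move=> cr i; apply: (@le_trans _ _ (r1 * (r1 ^+ k.+1)^-1)).
    by apply: le_trans (ler_wpM2r (normc_ge0 _) cr) _; apply: ler_wpM2l => //; exact: ltW.
  by rewrite exprS invfM mulrA mulfV ?mul1r// gt_eqF.
have L1 : r0 ^+ L.+1 <= r0 ^+ L by apply: ler_wiXn2l => //; exact: ltW.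
have nz (k' : R[i]) : r0 ^+ L <= normc k' -> k' != 0.
  by move=> h; rewrite -normc_gt0; apply: lt_le_trans h; rewrite exprn_gt0.
have bound1 (k' : R[i]) : r0 ^+ L <= normc k' <= 1 ->
    \sum_i W i * (g (k' * Z i) * G (kap * (k' * Z i))) ^+ q.+1 <=
    S + gam ^+ q.+1 * (KL * S).
  move=> /andP[k'0 k'1].
  have Zk' i : normc (kap * (k' * Z i)) <= (r1 ^+ k)^-1.
    rewrite !normcM mulrA; apply: Zr.
    by rewrite -[r1]mulr1; apply: ler_pM => //; exact: normc_ge0.
  have near := IH I (fun i => if gam < g (k' * Z i) then W i else 0)
    (fun i => kap * (k' * Z i)) M _ M0 Zk'.
  have far := IH I W (fun i => kap * (k' * Z i)) (KL * M) W0 _ Zk'.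
  apply: (@le_trans _ _ (\sum_i ((if gam < g (k' * Z i) then W i else 0) *
      G (kap * (k' * Z i)) ^+ q.+1 + gam ^+ q.+1 * (W i * G (kap * (k' * Z i)) ^+ q.+1)))).
    apply: ler_sum => i _; rewrite exprMn.
    have Gq0 : 0 <= G (kap * (k' * Z i)) ^+ q.+1 by rewrite exprn_ge0.
    case: ltP => hg.
      have : g (k' * Z i) ^+ q.+1 <= 1 by apply: exprn_ile1.
      have : 0 <= gam ^+ q.+1 * (W i * G (kap * (k' * Z i)) ^+ q.+1).
        by rewrite !mulr_ge0 ?exprn_ge0.
      move=> h1 h2; apply: ler_wpDr => //; apply: ler_wpM2l => //.
      exact: ler_piMl.
    rewrite mul0r add0r mulrCA; apply: ler_wpM2r; first by rewrite mulr_ge0.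
    by apply: lerXn2r; rewrite ?nnegrE.
  rewrite big_split/= -mulr_sumr; apply: lerD.
    apply: near; first by move=> i; case: ifP.
    apply: (@ball_mass_rigid R g kap k' r0 delta gam eta) => //.
    - by rewrite /rho; lra.
    - by rewrite /eta ler_pM2l.
    - exact: nz.
  apply: ler_wpM2l; first exact: exprn_ge0.
  rewrite -SKL; apply: far; first by rewrite mulr_ge0// ltW.
  have : ball_mass W (fun i => (kap * k') * Z i) rho (KL * M).
    apply: kfar.
      by rewrite mulf_neq0 ?(nz k')// -normc_gt0; exact: lt_le_trans rk0.
    by rewrite normcM exprS; apply: ler_pM => //; rewrite ?exprn_ge0// ltW.
  by congr (ball_mass _ _ _ _); apply/funext => i; rewrite mulrA.
have bound2 (k' : R[i]) : r0 ^+ L <= normc k' <= r1 ^+ L ->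
    \sum_i W i * G (k' * Z i) ^+ q.+1 <= KL * S.
  move=> /andP[k'0 k'1]; rewrite -SKL; apply: IH => //.
  - by rewrite mulr_ge0// ltW.
  - move=> i; rewrite normcM; apply: Zr; apply: (le_trans k'1).
    by rewrite -[leRHS]expr1; apply: ler_wiXn2l => //; exact: ltW.
  - by apply: kfar; [exact: nz | exact: le_trans L1 k'0].
have H := @sum_gain_expr_le R B P g kap p lam G r0 r1 I W Z L s m.+1 q e _ _ rec
  P0 P1 p0 pE g0 G0 (ltW r00) (ltW r11) lr erefl qE _ es1 W0 bound1 bound2.
apply: le_trans (H _) _; first by lra.
rewrite [leRHS](_ : _ = E * S); last by rewrite /S exprS; ring.
have -> : S + gam ^+ q.+1 * (KL * S) = (1 + gam ^+ q.+1 * KL) * S by ring.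
rewrite [(2 ^+ s)^-1 * _]mulrA [_^-1 * (_ * S)]mulrA -mulrDl; apply: ler_wpM2r => //.
(* At most [1 + e2 <= E], because [e2 <= 1]. *)
apply: (@le_trans _ _ ((1 + e2 / 4) * (1 + e2 / 4) + e2 / 4)); last by nra.
apply: lerD => //; apply: ler_pM => //.
- by rewrite invr_ge0; lra.
- by rewrite addr_ge0 ?mulr_ge0 ?exprn_ge0// ltW.
- by rewrite lerD2l.
Qed.

(** * Binomial weights *)

Definition binw (R : realType) (q : R) (n i : nat) : R :=
  'C(n, i)%:R * (1 - q) ^+ (n - i) * q ^+ i.

Definition binsum (R : realType) (q : R) (n : nat) (f : nat -> R) : R :=
  \sum_(i < n.+1) binw q n i * f i.

Lemma binw_ge0 (R : realType) (q : R) (n i : nat) :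
  0 <= q <= 1 -> 0 <= binw q n i.
Proof.
by move=> /andP[q0 q1]; rewrite !mulr_ge0 ?exprn_ge0// subr_ge0.
Qed.

Lemma binwS (R : realType) (q : R) (n i : nat) :
  binw q n.+1 i.+1 = (1 - q) * binw q n i.+1 + q * binw q n i.
Proof.
rewrite /binw binS natrD subSS.
have [ni|ni] := leqP n i.
  by rewrite bin_small ?ltnS// exprS; ring.
have -> : (n - i = (n - i.+1).+1)%N by rewrite subnSK.
by rewrite !exprS; ring.
Qed.

Lemma binsum0 (R : realType) (q : R) (f : nat -> R) : binsum q 0 f = f 0%N.
Proof. by rewrite /binsum big_ord_recl big_ord0 /binw bin0 !expr0 !mul1r addr0. Qed.

Lemma binsumS (R : realType) (q : R) (n : nat) (f : nat -> R) :
  binsum q n.+1 f = (1 - q) * binsum q n f + q * binsum q n (fun i => f i.+1).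
Proof.
have h : \sum_(i < n.+1) binw q n i * f i =
    binw q n 0 * f 0%N + \sum_(i < n.+1) binw q n i.+1 * f i.+1.
  rewrite [in RHS]big_ord_recr/= [X in _ = _ + (_ + X)](_ : _ = 0); last first.
    by rewrite /binw bin_small// !mul0r.
  by rewrite addr0 big_ord_recl.
rewrite /binsum h big_ord_recl.
have -> : binw q n.+1 (ord0 : 'I_n.+2) = (1 - q) * binw q n 0.
  by rewrite /binw !bin0 !subn0 exprS; ring.
have -> : \sum_(i < n.+1) binw q n.+1 (lift ord0 i) * f (lift ord0 i) =
    (1 - q) * (\sum_(i < n.+1) binw q n i.+1 * f i.+1)
    + q * (\sum_(i < n.+1) binw q n i * f i.+1).
  rewrite !mulr_sumr -big_split/=; apply: eq_bigr => i _.
  by rewrite /bump leq0n add1n binwS; ring.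
rewrite /=; ring.
Qed.

Lemma eq_binsum (R : realType) (q : R) (n : nat) (f g : nat -> R) :
  f =1 g -> binsum q n f = binsum q n g.
Proof. by move=> fg; apply: eq_bigr => i _; rewrite fg. Qed.

Lemma ler_binsum (R : realType) (q : R) (n : nat) (f g : nat -> R) :
  0 <= q <= 1 -> (forall i, f i <= g i) -> binsum q n f <= binsum q n g.
Proof.
by move=> q01 fg; apply: ler_sum => i _; apply: ler_wpM2l (fg _); exact: binw_ge0.
Qed.

Lemma binsum_lin (R : realType) (q c d : R) (n : nat) (f g : nat -> R) :
  binsum q n (fun i => c * f i + d * g i) = c * binsum q n f + d * binsum q n g.
Proof.
rewrite /binsum !mulr_sumr -big_split/=; apply: eq_bigr => i _; ring.
Qed.

Lemma binsum_cst (R : realType) (q c : R) (n : nat) : binsum q n (fun=> c) = c.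
Proof. by elim: n => [|n IH]; rewrite ?binsum0// binsumS IH; ring. Qed.

(** The shift [c] is left free because the induction step calls for [1 + c]; the variance is the
    case [c = - n q]. *)
Lemma binsum_variance (R : realType) (q c : R) (n : nat) :
  binsum q n (fun i => (i%:R + c) ^+ 2)
    = n%:R * q * (1 - q) + (n%:R * q + c) ^+ 2.
Proof.
elim: n c => [|n IH] c; first by rewrite binsum0 !mul0r !add0r.
rewrite binsumS IH (@eq_binsum _ _ _ _ (fun i => (i%:R + (1 + c)) ^+ 2)); last first.
  by move=> i; rewrite -natr1 addrA.
by rewrite IH -natr1; ring.
Qed.

(** Chebyshev's inequality, with the variance [n q (1 - q)] bounded by [n]. *)
Lemma binsum_tail (R : realType) (q h : R) (n : nat) : 0 <= q <= 1 -> 0 < h ->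
  binsum q n (fun i => (h < `|i%:R - n%:R * q|)%R%:R) <= n%:R / h ^+ 2.
Proof.
move=> q01 h0; have /andP[q0 q1] := q01.
apply: (@le_trans _ _ (binsum q n
   (fun i => (h ^+ 2)^-1 * (i%:R + (- (n%:R * q))) ^+ 2 + 0 * 0))).
  apply: ler_binsum => // i; rewrite mul0r addr0 [leRHS]mulrC ler_pdivlMr ?exprn_gt0//.
  case: ltP => hi; last by rewrite mul0r sqr_ge0.
  rewrite mul1r -[leRHS]real_normK ?num_real//; apply: lerXn2r; rewrite ?nnegrE ?(ltW h0)//.
  exact: ltW.
rewrite binsum_lin binsum_variance subrr mul0r addr0 expr0n/= addr0 [leLHS]mulrC.
apply: ler_wpM2r; first by rewrite invr_ge0 exprn_ge0// ltW.
by rewrite -mulrA ler_piMr//; nra.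
Qed.

(* A coin with bias [q <= 1/2] is a fair coin tossed with probability [2 q]. *)
Lemma binsum_fair_mixture (R : realType) (q : R) (n : nat) (f : nat -> R) :
  binsum q n f = binsum (2 * q) n (fun k => binsum (2^-1) k f).
Proof.
elim: n f => [|n IH] f; first by rewrite !binsum0.
rewrite !binsumS !IH; set g := fun k => binsum 2^-1 k (fun i => f i.+1).
rewrite (@eq_binsum _ _ _ (fun k => binsum _ k.+1 f)
  (fun k => 2^-1 * binsum 2^-1 k f + 2^-1 * g k)); last first.
  by move=> k; rewrite binsumS /g; congr (_ * _ + _); field.
by rewrite binsum_lin; field.
Qed.

Lemma bin_central_recurrence (k : nat) :
  (k.+1 * 'C(k.+1.*2, k.+1) = 2 * k.*2.+1 * 'C(k.*2, k))%N.
Proof.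
have h1 := mul_bin_diag k.+1.*2 k.
have h2 := mul_bin_down k.*2.+1 k.
rewrite /= in h1 h2.
have e : (k.*2.+1 - k = k.+1)%N by rewrite -addnn subSn ?leq_addr// addnK.
rewrite e in h2; rewrite -h1 doubleS.
apply/eqP; rewrite -(eqn_pmul2l (ltn0Sn k)); apply/eqP.
rewrite mulnCA -h2 -!muln2; ring.
Qed.

(** Through [bin_central_recurrence], the induction step reduces to
    [4 (2 k + 1) (2 k + 3) <= 16 (k + 1) ^ 2]. *)
Lemma bin_central_le (k : nat) :
  ('C(k.*2, k) ^ 2 * k.*2.+1 <= 16 ^ k)%N.
Proof.
elim: k => [|k IH]; first by rewrite bin0.
rewrite -(leq_pmul2l (m := (k.+1 ^ 2)%N)) ?expn_gt0//.
rewrite mulnA -expnMn bin_central_recurrence.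
apply: (@leq_trans ('C(k.*2, k) ^ 2 * k.*2.+1 * (16 * k.+1 ^ 2))); last first.
  apply: leq_trans (leq_mul IH (leqnn _)) _.
  by rewrite [(16 ^ _.+1)%N]expnS mulnCA mulnA mulnC.
have : (4 * (k.*2.+1 * k.+1.*2.+1) <= 16 * k.+1 ^ 2)%N by rewrite -!muln2; nia.
set c := 'C(_, _); move=> h.
have := leq_mul (leqnn (c ^ 2 * k.*2.+1)%N) h.
apply: leq_trans; rewrite leq_eqVlt; apply/orP; left; apply/eqP; ring.
Qed.

Lemma bin_le_central (k i : nat) : ('C(k.*2, i) <= 'C(k.*2, k))%N.
Proof.
have key m : (m <= k)%N -> ('C(k.*2, k - m) <= 'C(k.*2, k))%N.
  elim: m => [|m IH] mk; first by rewrite subn0.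
  apply: leq_trans (IH (ltnW mk)).
  have := mul_bin_left k.*2 (k - m.+1); rewrite subnSK// => h.
  rewrite -(leq_pmul2l (m := (k - m)%N)) ?subn_gt0// h.
  by rewrite leq_mul2r; apply/orP; right; rewrite -muln2; lia.
have [ik|ki] := leqP i k.
  by rewrite -(subKn ik); apply: key; exact: leq_subr.
have [ik2|ki2] := leqP i k.*2; last by rewrite bin_small.
rewrite -bin_sub// (_ : k.*2 - i = k - (i - k))%N; last by rewrite -muln2; lia.
by apply: key; rewrite -muln2 in ik2; lia.
Qed.

Lemma half01 (R : realType) : 0 <= (2^-1 : R) <= 1.
Proof. by apply/andP; split; lra. Qed.

Lemma binw_half (R : realType) (n i : nat) :
  binw (2^-1 : R) n i = 'C(n, i)%:R / 2 ^+ n.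
Proof.
rewrite /binw; have [ni|ni] := leqP i n; last by rewrite bin_small// !mul0r.
rewrite (_ : 1 - 2^-1 = 2^-1 :> R); last by field.
by rewrite -mulrA -exprD subnK// exprVn.
Qed.

(** For odd [n], conditioning on one toss makes a weight the half-sum of at most two weights of the
    even size [n - 1], where the central coefficient is the largest. The factor [2] absorbs
    [n + 1 <= 2 (2 k + 1)]. *)
Lemma binw_half_sqr_le (R : realType) (n i : nat) :
  binw (2^-1 : R) n i ^+ 2 <= 2 / n.+1%:R.
Proof.
pose k := n./2; pose b : R := 'C(k.*2, k)%:R / 2 ^+ k.*2.
have b0 : 0 <= b by rewrite divr_ge0 ?exprn_ge0.
have b1 : b ^+ 2 * k.*2.+1%:R <= 1.
  rewrite /b expr_div_n mulrAC ler_pdivrMr ?exprn_gt0// mul1r.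
  rewrite -!natrX -natrM ler_nat; apply: leq_trans (bin_central_le k) _.
  by rewrite -expnM -muln2 -mulnA mulnC expnM.
have even_le j : binw (2^-1 : R) k.*2 j <= b.
  by rewrite binw_half ler_pM2r ?invr_gt0 ?exprn_gt0// ler_nat bin_le_central.
have hb : binw (2^-1 : R) n i <= b.
  rewrite -(odd_double_half n) -/k; case: (odd n); last exact: even_le.
  rewrite add1n; case: i => [|i].
    rewrite /binw !bin0 !subn0 !expr0 exprS !mulr1 mul1r.
    have := even_le 0%N; rewrite /binw bin0 subn0 expr0 mulr1 mul1r.
    rewrite (_ : 1 - 2^-1 = 2^-1 :> R); last by field.
    move=> h; have h3 : 0 <= (2^-1 : R) ^+ k.*2 by apply: exprn_ge0; lra.
    lra.
  rewrite binwS; have := even_le i; have := even_le i.+1.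
  rewrite (_ : 1 - 2^-1 = 2^-1 :> R); last by field.
  lra.
rewrite ler_pdivlMr ?ltr0n//.
apply: (@le_trans _ _ (b ^+ 2 * (2 * k.*2.+1%:R))); last by rewrite mulrCA; lra.
apply: ler_pM => //; first exact: sqr_ge0.
  by apply: lerXn2r; rewrite ?nnegrE ?binw_ge0 ?half01.
rewrite -natrM ler_nat -{1}(odd_double_half n) -/k; case: (odd n); rewrite -muln2; lia.
Qed.

Lemma binsum_indic (R : realType) (q : R) (n i : nat) :
  binsum q n (fun j => (j == i)%:R) = if (i <= n)%N then binw q n i else 0.
Proof.
rewrite /binsum; case: leqP => ni.
  rewrite (bigD1 (Ordinal (ni : (i < n.+1)%N)))//= eqxx mulr1 big1 ?addr0//.
  by move=> j /eqP ji; case: eqP => [e|_]; rewrite ?mulr0//; case: ji; exact: val_inj.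
apply: big1 => j _; case: eqP => [e|_]; rewrite ?mulr0//.
by have := ltn_ord j; rewrite e ltnS leqNgt ni.
Qed.

(** By [(n + 1) C(n, i) = (i + 1) C(n + 1, i + 1)], multiplication by [(n + 1) q] yields the total
    mass of the binomial law of size [n + 1] without its term at [0]. *)
Lemma binsum_inv_succ_le (R : realType) (q : R) (n : nat) : 0 < q <= 1 ->
  binsum q n (fun i => i.+1%:R^-1) <= (n.+1%:R * q)^-1.
Proof.
move=> /andP[q0 q1]; have nq : 0 < n.+1%:R * q by rewrite mulr_gt0.
rewrite -[leRHS]mul1r ler_pdivlMr// mulrC /binsum mulr_sumr.
apply: (@le_trans _ _ (binsum q n.+1 (fun=> 1))); last by rewrite binsum_cst.
rewrite /binsum [leRHS]big_ord_recl.
rewrite -[leLHS]add0r; apply: lerD; first by rewrite mulr1 binw_ge0// ltW.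
apply: ler_sum => i _; rewrite mulr1 /= /bump leq0n add1n /binw subSS exprS.
have := mul_bin_diag n.+1 i; rewrite /= => h.
have e : n.+1%:R * 'C(n, i)%:R = i.+1%:R * 'C(n.+1, i.+1)%:R :> R by rewrite -!natrM h.
rewrite le_eqVlt; apply/orP; left; apply/eqP.
have i0 : i.+1%:R != 0 :> R by rewrite pnatr_eq0.
apply: (mulfI i0); rewrite !mulrA -e; field.
by rewrite addrC natr1.
Qed.

(** Conditionally on the number [k] of fair tosses the weight has square at most [2 / (k + 1)];
    Jensen's inequality and [binsum_inv_succ_le] with bias [2 q] average this bound. *)
Lemma binw_sqr_le (R : realType) (q : R) (n i : nat) : 0 < q -> 2 * q <= 1 ->
  binw q n i ^+ 2 <= (n.+1%:R * q)^-1.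
Proof.
move=> q0 q1; have nq : 0 < n.+1%:R * q by rewrite mulr_gt0.
have [ni|ni] := leqP i n; last by rewrite /binw bin_small// !mul0r expr0n/= invr_ge0 ltW.
have q2 : 0 <= 2 * q <= 1 by apply/andP; split; lra.
have -> : binw q n i = binsum q n (fun j => (j == i)%:R) by rewrite binsum_indic ni.
rewrite binsum_fair_mixture; set f := fun k => _.
have f0 k : 0 <= f k by rewrite /f binsum_indic; case: ifP => // _; rewrite binw_ge0// half01.
have f2 k : f k ^+ 2 <= 2 * k.+1%:R^-1 + 0 * 0.
  rewrite mul0r addr0 /f binsum_indic; case: ifP => _; first exact: binw_half_sqr_le.
  by rewrite expr0n/= mulr_ge0.
have w0 (k : 'I_n.+1) : 0 <= binw (2 * q) n k by exact: binw_ge0.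
have := @jensen_expr R _ (fun k : 'I_n.+1 => binw (2 * q) n k) (fun k => f k) 1 w0 (fun k => f0 k).
have -> : \sum_(k < n.+1) binw (2 * q) n k = 1.
  rewrite -[RHS](@binsum_cst _ (2 * q) 1 n); apply: eq_bigr => k _.
  by rewrite mulr1.
rewrite expr1n mul1r => h; apply: (le_trans h).
apply: (le_trans (ler_binsum n q2 f2)).
rewrite binsum_lin mul0r addr0.
have := @binsum_inv_succ_le R (2 * q) n; rewrite q1 andbT mulr_gt0// => /(_ isT) h'.
apply: (@le_trans _ _ (2 * (n.+1%:R * (2 * q))^-1)); first by rewrite ler_pM2l.
rewrite le_eqVlt; apply/orP; left; apply/eqP; field.
by rewrite gt_eqF//= pnatr_eq0.
Qed.

(** * Spreading a point over the powers of one multiplier *)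

Definition submean (R : realType) (A : finType) (p : A -> R) (lam : A -> R[i])
    (V : R[i] -> R) : Prop :=
  forall z, V z <= avg p lam V z.

(** The toss decides between the blocks [a^(2l) c] and [a^(2l+1) c]; [n] tosses put a binomial law
    on the exponent of [mu]. *)
Definition coin (R : realType) (q : R) (mu : R[i]) (V : R[i] -> R) (z : R[i]) : R :=
  (1 - q) * V z + q * V (mu * z).

Lemma iter_coinE (R : realType) (q : R) (mu : R[i]) (V : R[i] -> R) (n : nat) (z : R[i]) :
  iter n (coin q mu) V z = binsum q n (fun i => V (mu ^+ i * z)).
Proof.
elim: n z => [|n IH] z; first by rewrite binsum0 expr0 mul1r.
rewrite binsumS /= /coin !IH; congr (_ + _ * _).
by apply: eq_binsum => i; rewrite exprSr mulrA.
Qed.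

(** Multipliers commute, so a toss can be exchanged with a step of the walk. This allows spreading
    to be repeated on a function already tossed. *)
Lemma coin_submean (R : realType) (A : finType) (p : A -> R) (lam : A -> R[i])
    (q : R) (mu : R[i]) (V : R[i] -> R) : 0 <= q <= 1 ->
  submean p lam V -> submean p lam (coin q mu V).
Proof.
move=> /andP[q0 q1] sV z; rewrite /avg.
under eq_bigr => a _ do rewrite mulrDr !(mulrCA (p a)) (mulrCA mu).
rewrite big_split/= -!mulr_sumr; apply: lerD; apply: ler_wpM2l => //.
by rewrite subr_ge0.
Qed.

Lemma coin01 (R : realType) (q : R) (mu : R[i]) (V : R[i] -> R) : 0 <= q <= 1 ->
  (forall z, 0 <= V z <= 1) -> forall z, 0 <= coin q mu V z <= 1.
Proof.
move=> /andP[q0 q1] V01 z; have /andP[a b] := V01 z; have /andP[c d] := V01 (mu * z).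
rewrite /coin; apply/andP; split; first by rewrite addr_ge0 ?mulr_ge0// subr_ge0.
have : (1 - q) * V z <= (1 - q) * 1 by rewrite ler_wpM2l// subr_ge0.
have : q * V (mu * z) <= q * 1 by rewrite ler_wpM2l.
lra.
Qed.

(* Every word starts with [a^(2l) c] or [a^(2l+1) c] for some [c <> a], or
   with [a^(2L)]; the first two, for fixed [l] and [c], have weights in the
   ratio [1 : p a]. *)
Lemma coin_spread1 (R : realType) (A : finType) (p : A -> R) (lam : A -> R[i])
    (a : A) (r0 s : R) (V : R[i] -> R) (L : nat) (z : R[i]) :
  (forall c, 0 <= p c) -> \sum_c p c = 1 -> 0 <= r0 -> 0 <= s ->
  (forall c, r0 <= normc (lam c) <= 1) ->
  submean p lam V -> (forall z, 0 <= V z <= 1) ->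
  (forall k : R[i], (r0 ^+ 2) ^+ L * normc z <= normc k <= normc z ->
     coin (p a / (1 + p a)) (lam a) V k <= s) ->
  V z <= s + (p a ^+ 2) ^+ L.
Proof.
move=> p0 p1 r00 s0 lr sV V01.
have pa1 : p a <= 1 by rewrite -p1 (bigD1 a)//= lerDl sumr_ge0.
have V0 y : 0 <= V y by have /andP[] := V01 y.
have V1 y : V y <= 1 by have /andP[] := V01 y.
have r01 : r0 <= 1 by have /andP[/le_trans h /h] := lr a.
elim: L z => [|L IH] z Hs; first by rewrite expr0 (le_trans (V1 z))// lerDr.
have sum_ne : \sum_(c | c != a) p c = 1 - p a.
  by move: p1; rewrite (bigD1 a)//= => <-; ring.
(* The walk is expanded once, and once more only in the term of the letter [a]. *)
have step : V z <= \sum_(c | c != a) p c * (V (lam c * z) + p a * V (lam a * (lam c * z)))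
    + p a ^+ 2 * V (lam a * (lam a * z)).
  apply: (le_trans (sV z)); rewrite /avg (bigD1 a)//= addrC.
  have -> : \sum_(c | c != a) p c * (V (lam c * z) + p a * V (lam a * (lam c * z))) =
      \sum_(c | c != a) p c * V (lam c * z) +
      p a * \sum_(c | c != a) p c * V (lam c * (lam a * z)).
    rewrite mulr_sumr -big_split/=; apply: eq_bigr => c _.
    by rewrite mulrDr; congr (_ + _); rewrite mulrCA [lam a * _]mulrCA.
  rewrite -addrA lerD2l.
  apply: (le_trans (ler_wpM2l (p0 a) (sV _))).
  by rewrite /avg (bigD1 a)//= mulrDr addrC expr2 -[p a * p a * _]mulrA.
apply: (le_trans step).
have hc c : c != a -> V (lam c * z) + p a * V (lam a * (lam c * z)) <= (1 + p a) * s.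
  move=> _; have pa0 : 0 < 1 + p a by have := p0 a; lra.
  have -> : V (lam c * z) + p a * V (lam a * (lam c * z)) =
    (1 + p a) * coin (p a / (1 + p a)) (lam a) V (lam c * z).
    by rewrite /coin; field; rewrite gt_eqF.
  apply: ler_wpM2l; first exact: ltW.
  apply: Hs; have /andP[c0 c1] := lr c; rewrite normcM; apply/andP; split.
    apply: ler_wpM2r; rewrite ?normc_ge0//; apply: le_trans c0.
    by rewrite -exprM mulnS -[leRHS]expr1; apply: ler_wiXn2l.
  by apply: ler_piMl; rewrite ?normc_ge0.
have h2 : V (lam a * (lam a * z)) <= s + (p a ^+ 2) ^+ L.
  apply: IH => k /andP[k0 k1]; apply: Hs; have /andP[a0 a1] := lr a.
  apply/andP; split.
    apply: le_trans k0; rewrite exprSr -mulrA; apply: ler_wpM2l; first by rewrite !exprn_ge0.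
    rewrite !normcM expr2 -mulrA; apply: ler_pM => //; rewrite ?mulr_ge0 ?normc_ge0//.
    by apply: ler_wpM2r => //; exact: normc_ge0.
  apply: (le_trans k1); rewrite !normcM.
  apply: (@le_trans _ _ (normc (lam a) * normc z)).
    by apply: ler_piMl => //; rewrite mulr_ge0 ?normc_ge0.
  by apply: ler_piMl => //; exact: normc_ge0.
(* Since [(1 - p a) (1 + p a) + p a ^ 2 = 1], the bound [s] is recovered exactly and only the
   leftover shrinks by [p a ^ 2]. *)
apply: (@le_trans _ _ ((1 - p a) * ((1 + p a) * s) + p a ^+ 2 * (s + (p a ^+ 2) ^+ L))).
  apply: lerD; last by rewrite ler_wpM2l// sqr_ge0.
  rewrite -sum_ne mulr_suml; apply: ler_sum => c ca.
  by rewrite ler_wpM2l ?hc.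
rewrite le_eqVlt; apply/orP; left; apply/eqP; rewrite [in RHS]exprS; ring.
Qed.

(** Each of the [n] rounds applies [coin_spread1] to the function tossed so far; it costs
    [(p a ^ 2) ^ L] and shrinks the modulus at most by [(r0 ^ 2) ^ L]. *)
Lemma coin_spread (R : realType) (A : finType) (p : A -> R) (lam : A -> R[i])
    (a : A) (r0 s : R) (L n : nat) (V : R[i] -> R) (z : R[i]) :
  (forall c, 0 <= p c) -> \sum_c p c = 1 -> 0 <= r0 -> 0 <= s ->
  (forall c, r0 <= normc (lam c) <= 1) ->
  submean p lam V -> (forall z, 0 <= V z <= 1) ->
  (forall k : R[i], ((r0 ^+ 2) ^+ L) ^+ n * normc z <= normc k <= normc z ->
     iter n (coin (p a / (1 + p a)) (lam a)) V k <= s) ->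
  V z <= s + n%:R * (p a ^+ 2) ^+ L.
Proof.
move=> p0 p1 r00 s0 lr; set q := p a / (1 + p a).
have q01 : 0 <= q <= 1.
  have := p0 a => pa0; rewrite /q divr_ge0 ?addr_ge0//= ler_pdivrMr; lra.
elim: n V z => [|n IH] V z sV V01 Hs.
  by rewrite mul0r addr0; apply: Hs; rewrite expr0 mul1r lexx.
rewrite -natr1 mulrDl mul1r addrA.
apply: (@coin_spread1 _ _ _ lam a r0) => // [|k /andP[k0 k1]].
  by rewrite addr_ge0// mulr_ge0// !exprn_ge0.
apply: IH; [exact: coin_submean | exact: coin01 |].
move=> k' /andP[k'0 k'1]; rewrite -iterSr; apply: Hs; apply/andP; split.
  apply: le_trans k'0; rewrite exprSr -mulrA; apply: ler_wpM2l => //.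
  by rewrite !exprn_ge0.
exact: le_trans k1.
Qed.

(** * Stopping at a given scale *)

(** A stopped point ignores the remaining letters, so that one word serves points of different
    moduli. *)
Fixpoint stopped (R : realType) (A : finType) (lam : A -> R[i]) (T : R)
    (cs : seq A) (z : R[i]) : R[i] :=
  if cs is c :: cs' then
    stopped lam T cs' (if T < normc z then lam c * z else z)
  else z.

(** The same random word is used for all points. A running point satisfies the submean inequality, a
    stopped one is averaged with total weight [1], and a bound valid for every word bounds the
    average over words. *)
Lemma sum_stopped_le (R : realType) (A : finType) (p : A -> R) (lam : A -> R[i])
    (G : R[i] -> R) (T s : R) (I : finType) (W : I -> R) (Z : I -> R[i]) (M : nat) :
  (forall c, 0 <= p c) -> \sum_c p c = 1 -> submean p lam G ->
  (forall i, 0 <= W i) ->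
  (forall cs, size cs = M -> \sum_i W i * G (stopped lam T cs (Z i)) <= s) ->
  \sum_i W i * G (Z i) <= s.
Proof.
move=> p0 p1 sG W0; elim: M Z => [|M IH] Z Hs; first exact: (Hs [::]).
pose Zc c i := if T < normc (Z i) then lam c * Z i else Z i.
apply: (@le_trans _ _ (\sum_c p c * \sum_i W i * G (Zc c i))); last first.
  rewrite -[s]mul1r -p1 mulr_suml; apply: ler_sum => c _; apply: ler_wpM2l => //.
  by apply: IH => cs Mcs; apply: (Hs (c :: cs)); rewrite /= Mcs.
under [leRHS]eq_bigr do rewrite mulr_sumr.
rewrite exchange_big/=; apply: ler_sum => i _.
under [leRHS]eq_bigr do rewrite mulrCA.
rewrite -mulr_sumr; apply: ler_wpM2l => //; rewrite /Zc.
case: ltP => _; first exact: sG.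
by rewrite -mulr_suml p1 mul1r.
Qed.

Definition prod_take (R : realType) (A : finType) (lam : A -> R[i]) (cs : seq A)
    (t : nat) : R[i] := \prod_(c <- take t cs) lam c.

Lemma stoppedP (R : realType) (A : finType) (lam : A -> R[i]) (T : R)
    (cs : seq A) (z : R[i]) :
  exists t : nat, [/\ (t <= size cs)%N, stopped lam T cs z = prod_take lam cs t * z,
    (forall u, (u < t)%N -> T < normc (prod_take lam cs u * z)) &
    (t < size cs)%N -> normc (stopped lam T cs z) <= T].
Proof.
have no_stop cs' y : normc y <= T -> stopped lam T cs' y = y.
  by elim: cs' => //= c cs' IH yT; rewrite ltNge yT/= IH.
elim: cs z => [|c cs IH] z.
  by exists 0%N; split => //=; rewrite /prod_take big_nil mul1r.
have [zT|zT] := leP (normc z) T.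
  exists 0%N; split => //=; first by rewrite /prod_take big_nil mul1r ltNge zT/= no_stop.
  by rewrite ltNge zT/= no_stop.
have [t [ts tE tu tT]] := IH (lam c * z).
exists t.+1; split => //=; rewrite ?zT//.
  by rewrite tE /prod_take /= big_cons mulrCA mulrA.
move=> [_|u]; first by rewrite /prod_take big_nil mul1r.
by rewrite ltnS => /tu; rewrite /prod_take /= big_cons mulrCA mulrA.
Qed.

Lemma normc_prod_take (R : realType) (A : finType) (lam : A -> R[i]) (r0 r1 : R)
    (cs : seq A) (t u : nat) :
  0 <= r0 -> (forall c, r0 <= normc (lam c) <= r1) -> (t <= u)%N -> (u <= size cs)%N ->
  normc (prod_take lam cs t) * r0 ^+ (u - t) <= normc (prod_take lam cs u)
    <= normc (prod_take lam cs t) * r1 ^+ (u - t).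
Proof.
move=> r00 lr tu us; rewrite -(subnKC tu) addnC addnK.
have {us} : (t + (u - t) <= size cs)%N by rewrite subnKC.
elim: (u - t)%N => [|d IH] ds; first by rewrite add0n !expr0 !mulr1 lexx.
have [c0 _] : exists c : A, true.
  by case: cs ds {IH} => [|c cs]; [rewrite addnS | exists c].
have /IH/andP[h0 h1] : (t + d <= size cs)%N by apply: leq_trans ds; rewrite addnS.
have E : prod_take lam cs (d.+1 + t) = prod_take lam cs (d + t) * lam (nth c0 cs (d + t)).
  rewrite addSn /prod_take (take_nth c0); last by rewrite addnC -addnS.
  by rewrite -cats1 big_cat/= big_seq1.
have /andP[l0 l1] := lr (nth c0 cs (d + t)).
rewrite E normcM !exprSr !mulrA; apply/andP; split; apply: ler_pM => //.
- by rewrite mulr_ge0 ?exprn_ge0 ?normc_ge0.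
- exact: normc_ge0.
- exact: normc_ge0.
Qed.

Lemma stopped_le (R : realType) (A : finType) (lam : A -> R[i]) (r0 r1 T : R)
    (cs : seq A) (z : R[i]) :
  0 <= r0 -> (forall c, r0 <= normc (lam c) <= r1) ->
  normc z * r1 ^+ size cs <= T -> normc (stopped lam T cs z) <= T.
Proof.
move=> r00 lr zT; have [t [ts tE _ tT]] := stoppedP lam T cs z.
case: (ltnP t (size cs)) => [/tT//|st].
have {}st : t = size cs by apply/eqP; rewrite eqn_leq ts.
rewrite tE st normcM mulrC; apply: le_trans zT.
apply: ler_wpM2l; first exact: normc_ge0.
have /andP[_] := normc_prod_take r00 lr (leq0n (size cs)) (leqnn _).
by rewrite /prod_take take0 big_nil normc1 mul1r subn0.
Qed.

(* Within a family of initial points whose moduli agree up to a factor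
   [r1 ^- d], at most [d.+1] stopping times occur. *)
Lemma stopped_ball_mass (R : realType) (A : finType) (lam : A -> R[i]) (r0 r1 T sep rho w : R)
    (I : finType) (W : I -> R) (Z : I -> R[i]) (d : nat) (cs : seq A) :
  0 < r0 -> r1 < 1 -> 0 < T -> 0 <= w -> (forall c, r0 <= normc (lam c) <= r1) ->
  (forall i, 0 <= W i <= w) -> (forall i, T < normc (Z i)) ->
  (forall i, normc (Z i) * r1 ^+ size cs <= T) ->
  (forall i i', W i != 0 -> W i' != 0 -> r1 ^+ d * normc (Z i') <= normc (Z i)) ->
  (forall i i', i != i' -> sep * normc (Z i) <= normc (Z i - Z i')) ->
  0 <= sep -> 2 * rho < sep * (r0 * T) ->
  ball_mass W (fun i => stopped lam T cs (Z i)) rho (d.+1%:R * w).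
Proof.
move=> r00 r11 T0 w0 lr Ww ZT Zcs Zd Zsep sep0 rhos x.
(* Without letters the word is empty, and the two modulus hypotheses exclude every index. *)
case: (pickP (fun c : A => true)) => [c0 _|A0]; last first.
  case: cs Zcs => [|c cs]; last by have := A0 c.
  move=> Zcs; rewrite big_pred0 => [|i]; first by rewrite mulr_ge0.
  by have := Zcs i; rewrite expr0 mulr1 leNgt ZT.
have r1p : 0 < r1 by have /andP[/(lt_le_trans r00)/lt_le_trans h /h] := lr c0.
have [t tP] := choice (fun i => stoppedP lam T cs (Z i)).
have stT i : normc (stopped lam T cs (Z i)) <= T.
  exact: stopped_le (ltW r00) lr (Zcs i).
(* The last step started above [T] and multiplied the modulus by at least [r0]. *)
have stT0 i : r0 * T <= normc (stopped lam T cs (Z i)).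
  have [ts tE tu _] := tP i.
  case E : (t i) => [|u].
    have r01 : r0 <= 1 by have /andP[h1 h2] := lr c0; exact: le_trans (le_trans h1 h2) (ltW r11).
    rewrite tE E /prod_take take0 big_nil mul1r.
    by apply: le_trans (ltW (ZT i)); rewrite ler_piMl// ltW.
  have hu : (u < t i)%N by rewrite E.
  rewrite E in ts.
  have /andP[h _] := normc_prod_take (ltW r00) lr (leqnSn u) ts.
  rewrite subSnn expr1 in h.
  rewrite tE E normcM; apply: (@le_trans _ _ (normc (prod_take lam cs u) * r0 * normc (Z i))); last first.
    by rewrite ler_wpM2r ?normc_ge0.
  rewrite mulrAC mulrC -normcM; apply: ler_wpM2r; first exact: ltW.
  by apply: ltW; exact: tu.
(* Points stopped at the same time were multiplied by the same constant, so their relative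
   separation survives and keeps them out of a common ball of radius [rho]. *)
have inj i i' : t i = t i' -> normc (stopped lam T cs (Z i) - x) <= rho ->
    normc (stopped lam T cs (Z i') - x) <= rho -> i = i'.
  move=> tt hi hi'; apply/eqP; apply: contraT => ii'.
  have [_ tE _ _] := tP i; have [_ tE' _ _] := tP i'.
  have h1 : normc (stopped lam T cs (Z i) - stopped lam T cs (Z i')) <= 2 * rho.
    have -> : stopped lam T cs (Z i) - stopped lam T cs (Z i') =
      (stopped lam T cs (Z i) - x) - (stopped lam T cs (Z i') - x) by ring.
    by apply: le_trans (le_normcB _ _) _; lra.
  have h2 : sep * normc (stopped lam T cs (Z i)) <= normc (stopped lam T cs (Z i) - stopped lam T cs (Z i')).
    rewrite tE tE' -tt -mulrBr !normcM mulrCA; apply: ler_wpM2l; first exact: normc_ge0.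
    exact: Zsep.
  have h3 : sep * (r0 * T) <= sep * normc (stopped lam T cs (Z i)) by rewrite ler_wpM2l.
  by have := lt_le_trans rhos (le_trans h3 (le_trans h2 h1)); rewrite ltxx.
pose Q i := (normc (stopped lam T cs (Z i) - x) <= rho) && (W i != 0).
have -> : \sum_(i | normc (stopped lam T cs (Z i) - x) <= rho) W i = \sum_(i | Q i) W i.
  rewrite [RHS]big_mkcondr/=; apply: eq_bigr => i _.
  by case: eqVneq => [->|].
case: (pickP Q) => [i1 Qi1|Q0]; last first.
  by rewrite big_pred0// mulr_ge0.
pose i0 := [arg min_(i < i1 | Q i) t i].
have [Qi0 tmin] : Q i0 /\ forall i, Q i -> (t i0 <= t i)%N.
  by rewrite /i0; case: arg_minnP.
(* If [i] stopped later than [t i0 + d], then at time [t i - 1] its modulus would be at most that of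
   the stopped point [i0], hence at most [T], although it is still running. *)
have tlt i : Q i -> (t i - t i0 < d.+1)%N.
  move=> Qi; rewrite ltnS leqNgt; apply/negP => dt.
  have [ts tE tu _] := tP i; have [_ tE0 _ _] := tP i0.
  have hi : (0 < t i)%N by apply: leq_trans (leq_subr (t i0) _); exact: leq_trans dt.
  pose u := (t i).-1.
  have ut : (u < t i)%N by rewrite /u prednK.
  have t0u : (t i0 <= u)%N by rewrite /u -ltnS prednK// -subn_gt0; exact: leq_trans dt.
  have us : (u <= size cs)%N by apply: leq_trans ts; exact: ltnW.
  have /andP[_ h1] := normc_prod_take (ltW r00) lr t0u us.
  have h2 := tu _ ut.
  have /andP[_ Wi] := Qi; have /andP[_ Wi0] := Qi0.
  have h3 := Zd _ _ Wi0 Wi.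
  have h4 := stT i0; rewrite tE0 normcM in h4.
  have du : (d <= u - t i0)%N.
    by rewrite /u; move: (t i) (t i0) dt => a b; clear; lia.
  have : T < T; last by rewrite ltxx.
  apply: (lt_le_trans h2); rewrite normcM.
  apply: (le_trans (ler_wpM2r (normc_ge0 _) h1)).
  apply: le_trans h4; rewrite -mulrA; apply: ler_wpM2l; first exact: normc_ge0.
  apply: le_trans h3; apply: ler_wpM2r; first exact: normc_ge0.
  by apply: ler_wiXn2l => //; exact: ltW.
apply: (@le_trans _ _ (\sum_(i | Q i) w)).
  by apply: ler_sum => i _; have /andP[] := Ww i.
rewrite sumr_const -[_ *+ _]mulr_natl; apply: ler_wpM2r; first exact: w0.
rewrite ler_nat -[X in (_ <= X)%N]card_ord.
pose f i : 'I_d.+1 := inord (t i - t i0).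
have finj : {in [pred i | Q i] &, injective f}.
  move=> i i' Qi Qi' /(congr1 (@nat_of_ord _)); rewrite /f !inordK ?tlt// => e.
  have /andP[hi _] := Qi; have /andP[hi' _] := Qi'.
  apply: inj => //; move: (tmin _ Qi) (tmin _ Qi') e.
  by move: (t i) (t i') (t i0) => a b c; clear; lia.
by rewrite -(card_in_image finj); exact: max_card.
Qed.

(** * Decay from spreading and flattening *)

(** Separation relative to the modulus is invariant under a common multiplier. Its polynomial loss
    in [n] is what forces [T] to be a power of [n]. *)
Definition powers_separated (R : realType) (mu nu : R[i]) : Prop :=
  exists (c : R) (l : nat), 0 < c /\ forall (n i j i' j' : nat) (z : R[i]),
    (0 < n)%N -> (i <= n)%N -> (j <= n)%N -> (i' <= n)%N -> (j' <= n)%N ->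
    (i, j) != (i', j') ->
    c / n%:R ^+ l * normc (mu ^+ i * (nu ^+ j * z)) <=
      normc (mu ^+ i * (nu ^+ j * z) - mu ^+ i' * (nu ^+ j' * z)).

Lemma window_near (R : realType) (c h : R) (H i i' : nat) :
  h <= H%:R -> `|i%:R - c| <= h -> `|i'%:R - c| <= h -> (i <= i' + 2 * H)%N.
Proof.
rewrite !ler_norml => hH /andP[a b] /andP[a' b'].
by rewrite -(ler_nat R) natrD natrM; lra.
Qed.

(** The condition [r1 ^+ c <= r0] converts powers of [r0] into powers of [r1], in which
    [stopped_ball_mass] measures the spread of moduli. *)
Lemma normc_expr_window (R : realType) (mu : R[i]) (r0 r1 : R) (c H i i' : nat) :
  0 < r0 -> 0 <= r1 -> r1 ^+ c <= r0 -> r0 <= normc mu -> normc mu <= 1 -> (i <= i' + 2 * H)%N ->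
  r1 ^+ (c * (2 * H)) * normc (mu ^+ i') <= normc (mu ^+ i).
Proof.
move=> r00 r10 r1c m0 m1 ii; rewrite !normcX.
apply: (@le_trans _ _ (normc mu ^+ (i' + 2 * H))); last by apply: ler_wiXn2l; rewrite ?normc_ge0.
rewrite addnC exprD; apply: ler_wpM2r; first by rewrite exprn_ge0 ?normc_ge0.
rewrite exprM; apply: lerXn2r; rewrite ?nnegrE ?exprn_ge0 ?normc_ge0//.
exact: le_trans m0.
Qed.

Lemma iter_coin_submean (R : realType) (A : finType) (p : A -> R) (lam : A -> R[i])
    (q : R) (mu : R[i]) (V : R[i] -> R) (n : nat) : 0 <= q <= 1 ->
  submean p lam V -> submean p lam (iter n (coin q mu) V).
Proof. by move=> q01 sV; elim: n => //= n; exact: coin_submean. Qed.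

Lemma iter_coin01 (R : realType) (q : R) (mu : R[i]) (V : R[i] -> R) (n : nat) : 0 <= q <= 1 ->
  (forall z, 0 <= V z <= 1) -> forall z, 0 <= iter n (coin q mu) V z <= 1.
Proof. by move=> q01 V01; elim: n => //= n; exact: coin01. Qed.

Lemma binw_le (R : realType) (q x : R) (n i : nat) : 0 < q -> 2 * q <= 1 -> 0 < x ->
  x ^+ 2 <= n%:R -> binw q n i <= q^-1 / x.
Proof.
move=> q0 q1 x0 xn.
have b0 : 0 <= binw q n i by apply: binw_ge0; apply/andP; split; lra.
have qx : 0 <= q^-1 / x by rewrite divr_ge0 ?invr_ge0 ?ltW.
rewrite -(@ler_pXn2r _ 2)// ?nnegrE//; apply: le_trans (binw_sqr_le n i q0 q1) _.
rewrite exprMn !exprVn -invfM lef_pV2 ?posrE ?mulr_gt0 ?exprn_gt0 ?ltr0n//.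
have : q ^+ 2 <= q by rewrite expr2 ler_piMl ?(ltW q0)//; lra.
move=> q2; rewrite mulrC [n.+1%:R * q]mulrC mulrC; apply: ler_pM => //; rewrite ?sqr_ge0//.
by rewrite -natr1; lra.
Qed.

Lemma exists_gt1_expr_le2 (R : archiRealFieldType) (k : nat) :
  exists E : R, 1 < E /\ E ^+ k <= 2.
Proof.
pose x : R := (2 * k.+1%:R)^-1.
have x0 : 0 < x by rewrite invr_gt0 mulr_gt0.
have kx : k%:R * x <= 2^-1.
  rewrite /x invfM mulrCA ler_piMr ?invr_ge0// ler_pdivrMr// mul1r ler_nat.
  exact: leqnSn.
exists (1 + x); split; first by lra.
apply: le_trans (exprD1n_le (ltW x0) _) _; first by lra.
rewrite -[leRHS]invrK lef_pV2 ?posrE; lra.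
Qed.

(** A substitute for the root of order [q + 1] of one half. *)
Lemma exists_root_half (R : realFieldType) (q : nat) :
  exists tau : R, [/\ 2^-1 <= tau, tau < 1 & 2^-1 <= tau ^+ q.+1].
Proof.
pose x : R := (2 * q.+1%:R)^-1.
have x0 : 0 < x by rewrite invr_gt0 mulr_gt0.
have kx : q.+1%:R * x = 2^-1 by rewrite /x; field; rewrite addrC natr1.
have x2 : x <= 2^-1.
  by rewrite -kx ler_peMl ?(ltW x0)// ler1n.
exists (1 - x); split; [lra | lra |].
have := @bernoulli_ineq R q.+1 (- x); rewrite mulrN kx => h.
by apply: le_trans (h _); lra.
Qed.

Definition in_window (R : realType) (qa qb h : R) (n j i : nat) : bool :=
  (`|i%:R - n%:R * qa| <= h) && (`|j%:R - n%:R * qb| <= h).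

Lemma binsum_window (R : realType) (qa qb h : R) (n : nat)
    (F : nat -> nat -> R) :
  0 <= qa <= 1 -> 0 <= qb <= 1 -> 0 < h -> (forall j i, 0 <= F j i <= 1) ->
  binsum qb n (fun j => binsum qa n (F j)) <=
  \sum_(x : 'I_n.+1 * 'I_n.+1)
     (if in_window qa qb h n x.1 x.2 then binw qb n x.1 * binw qa n x.2 else 0) * F x.1 x.2
  + (n%:R / h ^+ 2 + n%:R / h ^+ 2).
Proof.
move=> qa01 qb01 h0 F01.
pose ta (i : nat) : R := (h < `|i%:R - n%:R * qa|)%R%:R.
pose tb (j : nat) : R := (h < `|j%:R - n%:R * qb|)%R%:R.
pose FW j i : R := (if in_window qa qb h n j i then 1 else 0) * F j i.
have le1 j i : F j i <= 1 * FW j i + 1 * (1 * ta i + tb j * 1).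
  have /andP[f0 f1] := F01 j i.
  rewrite /FW /ta /tb /in_window !ltNge.
  case: (`|i%:R - _| <= h); case: (`|j%:R - _| <= h);
  by rewrite /= ?mul1r ?mul0r; lra.
apply: (@le_trans _ _ (binsum qb n (fun j => 1 * binsum qa n (FW j) +
    1 * (1 * binsum qa n ta + tb j * 1)))).
  apply: ler_binsum => // j; rewrite -[X in tb j * X](@binsum_cst _ qa 1 n).
  by rewrite -!binsum_lin; apply: ler_binsum.
rewrite binsum_lin !mul1r; apply: lerD.
  rewrite /binsum [leRHS](_ : _ = \sum_(j < n.+1) \sum_(i < n.+1)
    (if in_window qa qb h n j i then binw qb n j * binw qa n i else 0) * F j i); last first.
    by rewrite pair_bigA.
  apply: ler_sum => j _; rewrite mulr_sumr; apply: ler_sum => i _.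
  rewrite /FW; case: ifP => _; last by rewrite !mul0r !mulr0.
  by rewrite mul1r mulrA.
rewrite (@eq_binsum _ _ _ _ (fun j => binsum qa n ta * 1 + 1 * tb j)); last first.
  by move=> j; rewrite !mulr1 !mul1r.
rewrite binsum_lin binsum_cst mulr1 mul1r; apply: lerD; exact: binsum_tail.
Qed.

(** With [n = 2 ^ (8 u)], each letter is spread in [n] rounds of depth [n], which shrinks the
    modulus by a factor exponential in [n ^ 2 = 2 ^ (16 u)]; hence the tower in the hypothesis on
    [z]. *)
Theorem flat_decay (R : realType) (A : finType) (p : A -> R) (lam : A -> R[i])
    (a b : A) (r0 r1 : R) (G : R[i] -> R) :
  (forall c, 0 < p c) -> \sum_c p c = 1 -> p a < 1 -> p b < 1 ->
  0 < r0 -> r1 < 1 -> (forall c, r0 <= normc (lam c) <= r1) ->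
  submean p lam G -> (forall z, 0 <= G z <= 1) ->
  powers_separated (lam a) (lam b) -> flat r1 G ->
  exists (K D tau : R), [/\ 0 <= K, 1 < D, 0 < tau, tau < 1 &
    forall (u : nat) (z : R[i]), D ^+ (2 ^ (16 * u)) <= normc z -> G z <= K * tau ^+ u].
Proof.
move=> p0 p1 pa1 pb1 r00 r11 lr sG G01 [c1 [l [c10 Hsep]]] [rho rho0 Hflat].
have G0 z : 0 <= G z by have /andP[] := G01 z.
have p0' c : 0 <= p c by exact: ltW.
have r1p : 0 < r1 by have /andP[/(lt_le_trans r00)/lt_le_trans h /h] := lr a.
have r01 : r0 <= 1 by have /andP[h1 h2] := lr a; exact: le_trans (le_trans h1 h2) (ltW r11).
have lr1 c : r0 <= normc (lam c) <= 1.
  by have /andP[h1 h2] := lr c; rewrite h1 (le_trans h2 (ltW r11)).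
pose qa := p a / (1 + p a); pose qb := p b / (1 + p b).
have qP c : p c < 1 -> let q := p c / (1 + p c) in [/\ 0 < q, 2 * q <= 1 & 0 <= q <= 1].
  move=> pc1 q; have pc0 := p0 c.
  have q0 : 0 < q by rewrite divr_gt0// addr_gt0.
  have q1 : 2 * q <= 1 by rewrite /q mulrA ler_pdivrMr ?addr_gt0//; lra.
  by split=> //; apply/andP; split; lra.
have [qa0 qa2 qa01] := qP a pa1; have [qb0 qb2 qb01] := qP b pb1.
rewrite -/qa in qa0 qa2 qa01; rewrite -/qb in qb0 qb2 qb01.
have [c hc] := expr_small (ltW r1p) r11 r00.
(* Makes the separation at modulus [r0 * T] equal to [4 * rho], above the required [2 * rho]. *)
pose T0 := 4 * rho / (c1 * r0).
have T00 : 0 < T0 by rewrite divr_gt0 ?mulr_gt0.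
have ir1 : 1 < r1^-1 by rewrite invf_gt1.
(* These exponents give [T <= r1 ^- (k1 u + k2)], so flatness loses at most [E ^ (k1 u + k2)]; [E]
   is then taken with [E ^ k1 <= 2]. *)
have [k1 hk1] := expr_large (2 ^+ (8 * l)) ir1.
have [k2 hk2] := expr_large T0 ir1.
have [E [E1 Ek1]] := exists_gt1_expr_le2 R k1.
have [q [C [C0 HC]]] := Hflat E E1.
have [tau [tau2 tau1 tauq]] := exists_root_half R q.
have tau0 : 0 < tau by lra.
pose Cw := qb^-1 * qa^-1.
have Cw0 : 0 < Cw by rewrite mulr_gt0 ?invr_gt0.
pose C' := C * E ^+ k2 * (4 * c + 1)%:R * Cw.
have C'0 : 0 <= C'.
  have E0 : 0 <= E by lra.
  apply: mulr_ge0 (ltW Cw0); apply: mulr_ge0 => //; apply: mulr_ge0 => //.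
  exact: exprn_ge0.
pose K0 := 1 + C'.
have K01 : 1 <= K0 by rewrite /K0; lra.
pose Ka := (((p a)^-1 - 1)^-1) ^+ 2; pose Kb := (((p b)^-1 - 1)^-1) ^+ 2.
(* The exponent [6 = 2 + 2 + 2] pays for the two spreadings, [r0 ^ (2 n ^ 2)] each, and for the
   powers of [lam a] and [lam b], at most [r0 ^ (2 n)]. *)
pose D := (T0 + 1) * 2 ^+ (8 * l) / r0 ^+ 6 + 1.
have D0 : 0 < (T0 + 1) * 2 ^+ (8 * l) / r0 ^+ 6.
  by rewrite divr_gt0 ?mulr_gt0 ?exprn_gt0//; lra.
exists (K0 + 2 + Kb + Ka), D, tau; split => //.
- by rewrite !addr_ge0 ?sqr_ge0//; lra.
- by rewrite /D; lra.
move=> u z zD.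
(* With [X = 2 ^ u]: leaving the window of half-width [H = X ^ 6] costs [2 n / H ^ 2 = 2 X ^- 4].
   Inside, each point has mass [O(X ^- 8)] and [O(H)] stopping times occur, so balls have mass
   [O(X ^- 2)]; flatness loses [O(X)], which leaves [O(X ^- 1)]. *)
pose n := (2 ^ (8 * u))%N; pose H := (2 ^ (6 * u))%N; pose X : R := 2 ^+ u.
have X0 : 0 < X by rewrite exprn_gt0.
have X1 : 1 <= X by rewrite exprn_ege1// ler1n.
have nX : n%:R = X ^+ 8 :> R by rewrite /n /X natrX -exprM mulnC.
have HX : H%:R = X ^+ 6 :> R by rewrite /H /X natrX -exprM mulnC.
have n0 : (0 < n)%N by rewrite expn_gt0.
have iXtau : X^-1 <= tau ^+ u.
  by rewrite /X -exprVn; apply: lerXn2r; rewrite ?nnegrE ?invr_ge0// ltW.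
have iX0 : 0 < X^-1 by rewrite invr_gt0.
have iXle m : (0 < m)%N -> X^-1 ^+ m <= X^-1.
  move=> m0; rewrite -[leRHS]expr1; apply: ler_wiXn2l => //; first exact: ltW.
  by rewrite invf_le1.
pose T := T0 * X ^+ (8 * l).
have TT0 : 0 < T by rewrite mulr_gt0 ?exprn_gt0.
pose sep := c1 / n%:R ^+ l.
have sep0 : 0 <= sep by rewrite divr_ge0 ?exprn_ge0 ?(ltW c10).
have sepT : 2 * rho < sep * (r0 * T).
  have -> : sep * (r0 * T) = 4 * rho.
    rewrite /sep /T nX -exprM /T0; field.
    by rewrite !gt_eqF ?exprn_gt0.
  lra.
pose s2 := K0 * tau ^+ u + 2 * X^-1 ^+ 4.
have s20 : 0 <= s2.
  by rewrite addr_ge0 ?mulr_ge0 ?exprn_ge0 ?(ltW iX0) ?(ltW tau0)//; lra.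
have core k : T < r0 ^+ (2 * n) * normc k ->
    iter n (coin qb (lam b)) (iter n (coin qa (lam a)) G) k <= s2.
  move=> kT; pose F j i := G (lam a ^+ i * (lam b ^+ j * k)).
  have -> : iter n (coin qb (lam b)) (iter n (coin qa (lam a)) G) k =
      binsum qb n (fun j => binsum qa n (F j)).
    by rewrite iter_coinE; apply: eq_binsum => j; rewrite iter_coinE.
  have H0 : 0 < H%:R :> R by rewrite HX exprn_gt0.
  apply: (le_trans (binsum_window n qa01 qb01 H0 (fun j i => G01 _))).
  have tailE : n%:R / H%:R ^+ 2 = X^-1 ^+ 4 :> R.
    by rewrite nX HX exprVn; field; rewrite gt_eqF.
  rewrite tailE /s2; apply: lerD; last by rewrite mulr2n mulrDl mul1r.
  set win := in_window qa qb H%:R n.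
  pose W (x : 'I_n.+1 * 'I_n.+1) : R :=
    if win x.1 x.2 then binw qb n x.1 * binw qa n x.2 else 0.
  pose Z (x : 'I_n.+1 * 'I_n.+1) : R[i] := lam a ^+ x.2 * (lam b ^+ x.1 * k).
  rewrite -[leLHS]/(\sum_x W x * G (Z x)).
  pose w := Cw * X^-1 ^+ 8.
  have w0 : 0 <= w by rewrite mulr_ge0 ?exprn_ge0 ?(ltW iX0) ?(ltW Cw0).
  have Ww x : 0 <= W x <= w.
    rewrite /W; case: ifP => _; last by rewrite lexx.
    have b1 := binw_ge0 n x.1 qb01; have b2 := binw_ge0 n x.2 qa01.
    rewrite mulr_ge0//=.
    have -> : w = qb^-1 / X ^+ 4 * (qa^-1 / X ^+ 4).
      by rewrite /w /Cw; field; rewrite !gt_eqF.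
    by apply: ler_pM => //; apply: binw_le; rewrite ?exprn_gt0// -exprM nX.
  have W0 x : 0 <= W x by have /andP[] := Ww x.
  have Zlow x : T < normc (Z x).
    apply: (lt_le_trans kT); rewrite /Z !normcM mulrA; apply: ler_wpM2r; first exact: normc_ge0.
    have e : r0 ^+ (2 * n) = r0 ^+ n * r0 ^+ n by rewrite -exprD mul2n addnn.
    have hx c' (i : 'I_n.+1) : r0 ^+ n <= normc (lam c' ^+ i).
      rewrite normcX; apply: (@le_trans _ _ (r0 ^+ i)).
        by apply: ler_wiXn2l; rewrite ?(ltW r00)// -ltnS.
      by apply: lerXn2r; rewrite ?nnegrE ?normc_ge0 ?(ltW r00)//; have /andP[] := lr c'.
    by rewrite e; apply: ler_pM; rewrite ?exprn_ge0 ?(ltW r00).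
  have Zup x : normc (Z x) <= normc k.
    have hx c' (i : nat) : normc (lam c' ^+ i) <= 1.
      by rewrite normcX; apply: exprn_ile1; rewrite ?normc_ge0//; have /andP[] := lr1 c'.
    rewrite /Z !normcM mulrA ler_piMl ?normc_ge0//.
    by rewrite -[leRHS]mul1r; apply: ler_pM; rewrite ?normc_ge0.
  (* A word length after which every point is below [T]. *)
  have [M hM] : exists M : nat, normc k * r1 ^+ M <= T.
    have k0 : 0 < normc k.
      by have := lt_trans TT0 (Zlow (ord0, ord0)) => /lt_le_trans; exact.
    have [M hM] := expr_small (ltW r1p) r11 (divr_gt0 TT0 k0).
    by exists M; rewrite mulrC -ler_pdivlMr.
  apply: (@sum_stopped_le R A p lam G T _ _ W Z M) => // cs csM.
  (* Within the window each of the two exponents varies by at most [2 * H], and one unit changes the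
     modulus by a factor at least [r0 >= r1 ^+ c]. *)
  pose d := (c * (2 * H) + c * (2 * H))%N.
  have Zcs x : normc (Z x) * r1 ^+ size cs <= T.
    rewrite csM; apply: le_trans hM; apply: ler_wpM2r => //.
    by rewrite exprn_ge0// ltW.
  have mass : ball_mass W (fun x => stopped lam T cs (Z x)) rho (d.+1%:R * w).
    apply: (@stopped_ball_mass R A lam r0 r1 T sep) => //.
    - move=> x x' Wx Wx'.
      have wx : win x.1 x.2 by move: Wx; rewrite /W; case: ifP; rewrite ?eqxx.
      have wx' : win x'.1 x'.2 by move: Wx'; rewrite /W; case: ifP; rewrite ?eqxx.
      move: wx wx' => /andP[x2 x1] /andP[x'2 x'1].
      have i2 := window_near (lexx _) x2 x'2; have i1 := window_near (lexx _) x1 x'1.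
      have /andP[la0 la1] := lr1 a; have /andP[lb0 lb1] := lr1 b.
      have h2 := normc_expr_window r00 (ltW r1p) hc la0 la1 i2.
      have h1 := normc_expr_window r00 (ltW r1p) hc lb0 lb1 i1.
      rewrite /Z !normcM /d; set e := (c * (2 * H))%N in h1 h2 *.
      have -> : r1 ^+ (e + e) * (normc (lam a ^+ x'.2) * (normc (lam b ^+ x'.1) * normc k)) =
          (r1 ^+ e * normc (lam a ^+ x'.2)) * ((r1 ^+ e * normc (lam b ^+ x'.1)) * normc k).
        by rewrite exprD; ring.
      have r1e : 0 <= r1 ^+ e by rewrite exprn_ge0// ltW.
      apply: ler_pM => //; rewrite ?mulr_ge0 ?normc_ge0//.
      by apply: ler_wpM2r => //; exact: normc_ge0.
    - move=> x x' xx'.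
      have xx2 : (val x.2, val x.1) != (val x'.2, val x'.1).
        apply: contra xx' => /eqP[e2 e1]; case: x x' e1 e2 => [x1 x2] [x1' x2'] /= e1 e2.
        by apply/eqP; congr (_, _); exact: val_inj.
      have ord_le (y : 'I_n.+1) : (y <= n)%N by rewrite -ltnS.
      exact: (Hsep n x.2 x.1 x'.2 x'.1 k n0 (ord_le _) (ord_le _) (ord_le _) (ord_le _) xx2).
  have stT x : normc (stopped lam T cs (Z x)) <= (r1 ^+ (k1 * u + k2))^-1.
    apply: (le_trans (stopped_le (ltW r00) lr (Zcs x))).
    rewrite /T -exprVn exprD mulrC; apply: ler_pM => //; rewrite ?exprn_ge0 ?(ltW T00) ?(ltW X0)//.
    by rewrite /X -exprM [(u * _)%N]mulnC !exprM; apply: lerXn2r; rewrite ?nnegrE ?exprn_ge0 ?invr_ge0 ?(ltW r1p)// -?exprM.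
  have m0 : 0 <= d.+1%:R * w by rewrite mulr_ge0.
  have bound := HC _ _ W (fun x => stopped lam T cs (Z x)) _ W0 m0 stT mass.
  have {}bound : \sum_x W x * G (stopped lam T cs (Z x)) ^+ q.+1 <= C' * X^-1.
    apply: (le_trans bound).
    have e1 : E ^+ (k1 * u + k2) <= X * E ^+ k2.
      rewrite exprD exprM; apply: ler_wpM2r; first by rewrite exprn_ge0//; lra.
      by apply: lerXn2r; rewrite ?nnegrE ?exprn_ge0//; lra.
    have e2 : d.+1%:R <= (4 * c + 1)%:R * X ^+ 6.
      rewrite -HX -natrM ler_nat /d; have : (0 < H)%N by rewrite expn_gt0.
      by clear; nia.
    rewrite (_ : C' * X^-1 = C * (X * E ^+ k2) * ((4 * c + 1)%:R * X ^+ 6 * w)); last first.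
      by rewrite /C' /w; field; rewrite gt_eqF.
    apply: ler_pM => //.
    - by rewrite mulr_ge0// exprn_ge0//; lra.
    - by apply: ler_wpM2l.
    - by apply: ler_wpM2r.
  have sW : \sum_x W x <= 1.
    apply: (@le_trans _ _ (\sum_(x : 'I_n.+1 * 'I_n.+1) binw qb n x.1 * binw qa n x.2)).
      apply: ler_sum => x _; rewrite /W; case: ifP => // _.
      by rewrite mulr_ge0 ?binw_ge0.
    rewrite -(pair_bigA _ (fun j i : 'I_n.+1 => binw qb n j * binw qa n i))/=.
    under eq_bigr do rewrite -mulr_sumr.
    rewrite -mulr_suml.
    have e q' : \sum_(j < n.+1) binw q' n j = 1.
      rewrite -[RHS](@binsum_cst _ q' 1 n); apply: eq_bigr => j _.
      by rewrite mulr1.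
    by rewrite !e mulr1.
  (* Jensen's inequality removes the power [q + 1], and [X ^- 1] becomes [tau ^ u]. *)
  rewrite -(@ler_pXn2r _ q.+1)// ?nnegrE; last 2 first.
  - by apply: sumr_ge0 => x _; rewrite mulr_ge0.
  - by rewrite mulr_ge0 ?exprn_ge0 ?(ltW tau0)//; lra.
  apply: (le_trans (jensen_expr q W0 (fun x => G0 _))).
  apply: (@le_trans _ _ (1 * (C' * X^-1))).
    apply: ler_pM => //.
    - by rewrite exprn_ge0// sumr_ge0.
    - by apply: sumr_ge0 => x _; rewrite mulr_ge0 ?exprn_ge0.
    - by apply: exprn_ile1 => //; apply: sumr_ge0.
  rewrite mul1r exprMn; apply: ler_pM => //.
  - exact: ltW.
  - apply: (@le_trans _ _ K0); first by rewrite /K0; lra.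
    by rewrite exprS ler_peMr ?exprn_ege1//; lra.
  - rewrite -exprM mulnC exprM /X -exprVn; apply: lerXn2r; rewrite ?nnegrE//.
    by rewrite exprn_ge0// ltW.
have pX e : 0 < e -> e < 1 -> n%:R * (e ^+ 2) ^+ n <= ((e^-1 - 1)^-1) ^+ 2 * X^-1.
  move=> e0 e1; have h := natr_mul_expr_le n e0 e1.
  have hh : n%:R * (n%:R * (e ^+ 2) ^+ n) <= ((e^-1 - 1)^-1) ^+ 2.
    have -> : n%:R * (n%:R * (e ^+ 2) ^+ n) = (n%:R * e ^+ n) ^+ 2.
      by rewrite exprAC; ring.
    apply: lerXn2r => //; rewrite ?nnegrE.
      by rewrite mulr_ge0 ?exprn_ge0 ?(ltW e0).
    by apply: le_trans h; rewrite mulr_ge0 ?exprn_ge0 ?(ltW e0).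
  rewrite -(ler_pM2l (x := n%:R)) ?ltr0n//; apply: (le_trans hh).
  rewrite mulrCA ler_peMr ?sqr_ge0// nX ler_pdivlMr// mul1r.
  by rewrite -[leLHS]expr1; apply: ler_weXn2l.
have conv : s2 + n%:R * (p b ^+ 2) ^+ n + n%:R * (p a ^+ 2) ^+ n
    <= (K0 + 2 + Kb + Ka) * tau ^+ u.
  have h4 := iXle 4%N isT; have ha := pX _ (p0 a) pa1; have hb := pX _ (p0 b) pb1.
  rewrite -/Ka in ha; rewrite -/Kb in hb.
  have Ka0 : 0 <= Ka by exact: sqr_ge0.
  have Kb0 : 0 <= Kb by exact: sqr_ge0.
  have ha' := ler_wpM2l Ka0 iXtau; have hb' := ler_wpM2l Kb0 iXtau.
  rewrite /s2 !mulrDl; lra.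
apply: le_trans conv.
(* Spreading along [a], then along [b] for the function already tossed; depth [L = n] makes the
   leftovers [n (p a ^ 2) ^ n] and [n (p b ^ 2) ^ n]. *)
apply: (@coin_spread R A p lam a r0 _ n n) => //; first exact: ltW.
  by rewrite addr_ge0// mulr_ge0// !exprn_ge0.
move=> k /andP[k0 _].
apply: (@coin_spread R A p lam b r0 _ n n) => //; first exact: ltW.
- exact: iter_coin_submean.
- exact: iter_coin01.
move=> k' /andP[k'0 _]; apply: core.
pose N := (2 ^ (16 * u))%N.
have nnN : (n * n = N)%N by rewrite /n /N -expnD -mulnDl.
have N0 : (0 < N)%N by rewrite expn_gt0.
have uN : (u <= N)%N.
  by apply: leq_trans (ltnW (ltn_expl u (ltnSn 1))) _; rewrite leq_exp2l// leq_pmull.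
pose Y := ((r0 ^+ 2) ^+ n) ^+ n.
have Y0 : 0 <= Y by rewrite !exprn_ge0// ltW.
have YE : Y = r0 ^+ (2 * N) by rewrite /Y -!exprM nnN.
apply: (@lt_le_trans _ _ (r0 ^+ (2 * n) * (Y * (Y * D ^+ N)))); last first.
  apply: ler_wpM2l; first by rewrite exprn_ge0// ltW.
  apply: le_trans k'0; apply: ler_wpM2l => //.
  by apply: le_trans k0; apply: ler_wpM2l.
pose D1 := (T0 + 1) * 2 ^+ (8 * l).
apply: (@lt_le_trans _ _ (D1 ^+ N)).
  rewrite /D1 exprMn /T; apply: (@le_lt_trans _ _ (T0 * (2 ^+ (8 * l)) ^+ N)).
    apply: ler_wpM2l; first exact: ltW.
    rewrite /X exprAC; apply: ler_weXn2l => //.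
    by rewrite exprn_ege1// ler1n.
  rewrite ltr_pM2r ?exprn_gt0//; apply: (@lt_le_trans _ _ (T0 + 1)); first by rewrite ltrDl.
  by rewrite -[leLHS]expr1; apply: ler_weXn2l => //; lra.
have r0N : r0 ^+ (2 * N) <= r0 ^+ (2 * n).
  apply: ler_wiXn2l => //; first exact: ltW.
  by rewrite leq_mul2l/= -nnN leq_pmulr.
apply: (@le_trans _ _ (r0 ^+ (2 * N) * (Y * (Y * (D1 / r0 ^+ 6) ^+ N)))).
  rewrite YE expr_div_n le_eqVlt; apply/orP; left; apply/eqP.
  rewrite -[in RHS]exprM [in RHS](_ : (6 * N = 2 * N + (2 * N + 2 * N))%N); last by clear; lia.
  by rewrite !exprD; field; rewrite expf_neq0// gt_eqF.
apply: ler_pM => //.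
- by rewrite exprn_ge0// ltW.
- by rewrite !mulr_ge0// exprn_ge0// ltW.
apply: ler_wpM2l => //; apply: ler_wpM2l => //.
apply: lerXn2r; rewrite ?nnegrE ?(ltW D0)//; rewrite /D; move: D0; rewrite -/D1.
  by lra.
by rewrite lerDl.
Qed.

(** * Separation and rigidity *)

Import numFieldNormedType.Exports.

(** The mean value theorem gives [cos 1 * y <= sin y] on [[0, 1]]; the duplication formula reaches
    [2], hence beyond [pi / 2]. *)
Lemma sin_ge_linear (R : realType) (x : R) : 0 <= x <= 2 ->
  cos 1 ^+ 2 * x <= sin x.
Proof.
have c1 : 0 < cos (1 : R) by exact: cos1_gt0.
have small (y : R) : 0 <= y -> y <= 1 -> cos 1 * y <= sin y.
  move=> y0 y1.
  have [|c] := @MVT_segment R sin cos 0 y y0 (fun x _ => is_derive_sin x).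
    by apply: continuous_subspaceT; exact: continuous_sin.
  rewrite in_itv/= sin0 !subr0 => /andP[c0 cy] ->.
  apply: ler_wpM2r => //; rewrite leNgt; apply/negP => h.
  have pi2 := @pi_ge2 R.
  have := h; rewrite ltr_cos; last 2 first.
  - by rewrite in_itv/=; apply/andP; split; lra.
  - by rewrite in_itv/=; apply/andP; split; lra.
  by rewrite ltNge; lra.
move=> /andP[x0 x2]; pose y := x / 2.
have -> : x = y *+ 2 by rewrite /y -mulr_natr; field.
have y0 : 0 <= y by rewrite /y; lra.
have y1 : y <= 1 by rewrite /y; lra.
rewrite sin_mulr2n.
have hc : cos 1 <= cos y.
  have pi2 := @pi_ge2 R.
  rewrite leNgt; apply/negP; rewrite ltr_cos; last 2 first.
  - by rewrite in_itv/=; apply/andP; split; lra.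
  - by rewrite in_itv/=; apply/andP; split; lra.
  by rewrite ltNge; lra.
have hs := small y y0 y1.
have : cos 1 * (cos 1 * y) <= cos y * sin y.
  by apply: ler_pM => //; rewrite ?mulr_ge0// ltW.
by move=> h; rewrite -[y *+ 2]mulr_natl -[leRHS]mulr_natl; lra.
Qed.

Lemma norm_sin_pi (R : realType) (y : R) : `|y| <= 2^-1 ->
  cos 1 ^+ 2 * `|y| <= `|sin (pi * y)|.
Proof.
move=> y2; have pi2 := @pi_ge2 R; have pi4 := @pihalf_lt2 R.
have ay : `|pi * y| = pi * `|y| by rewrite normrM ger0_norm ?pi_ge0.
have h : 0 <= pi * `|y| <= 2.
  rewrite mulr_ge0 ?pi_ge0//=; apply: (@le_trans _ _ (pi * 2^-1)); last exact: ltW.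
  by rewrite ler_wpM2l ?pi_ge0.
have := sin_ge_linear h; rewrite -ay => hs.
have -> : `|sin (pi * y)| = `|sin `|pi * y| |.
  by case: (ger0P (pi * y)) => // _; rewrite sinN normrN.
apply: le_trans (ler_norm _); apply: le_trans hs; rewrite ay.
apply: ler_wpM2l; first exact: sqr_ge0.
by rewrite ler_peMl//; lra.
Qed.

Lemma norm_sinDpiz (R : realType) (x : R) (k : int) :
  `|sin (x + pi * k%:~R)| = `|sin x|.
Proof.
have nat_case (y : R) (n : nat) : `|sin (y + pi * n%:R)| = `|sin y|.
  elim: n => [|n IH]; first by rewrite mulr0 addr0.
  by rewrite -natr1 mulrDr mulr1 addrA sinDpi normrN.
case: k => n; first by rewrite nat_case.
rewrite NegzE mulrNz mulrN -(nat_case (x - _) n.+1).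
by rewrite pmulrn subrK.
Qed.

(** The nearest integer can be subtracted from [y] because [|sin|] has period [pi]. *)
Lemma norm_sin_pi_ge (R : realType) (y m : R) :
  (forall k : int, m <= `|y - k%:~R|) -> cos 1 ^+ 2 * m <= `|sin (pi * y)|.
Proof.
move=> ym; pose k := Num.floor (y + 2^-1).
have /andP[k1 k2] := floor_itv (y + 2^-1); rewrite -/k in k1 k2.
have hd : `|y - k%:~R| <= 2^-1.
  by rewrite ler_norml; rewrite intrD in k2; apply/andP; split; lra.
have -> : pi * y = pi * (y - k%:~R) + pi * k%:~R by ring.
rewrite norm_sinDpiz; apply: le_trans (norm_sin_pi hd).
by apply: ler_wpM2l => //; exact: sqr_ge0.
Qed.

(** The sine of [2 pi x] also vanishes at half-integers [x], so the Diophantine condition is applied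
    to [(2 p, 2 q)]. The real exponent [l] is rounded up to a natural [L]. *)
Lemma diophantine_sin (R : realType) (t1 t2 : R) : diophantine_pair t1 t2 ->
  exists (c : R) (L : nat), 0 < c /\ forall (n : nat) (p q : int),
    (0 < n)%N -> (`|p| <= n)%N -> (`|q| <= n)%N -> (p, q) <> (0, 0) ->
    c / n%:R ^+ L <= `|sin (2 * pi * (p%:~R * t1 + q%:~R * t2))|.
Proof.
move=> [C [l [C0 l0 H]]].
have [L hL] := natr_bound l.
have c1 : 0 < cos (1 : R) by exact: cos1_gt0.
exists (cos 1 ^+ 2 * (C / 2 ^+ L)), L; split; first by rewrite mulr_gt0 ?divr_gt0 ?exprn_gt0.
move=> n p q n0 pn qn pq.
have -> : 2 * pi * (p%:~R * t1 + q%:~R * t2) =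
   pi * ((2 * p)%:~R * t1 + (2 * q)%:~R * t2) by rewrite !intrM; ring.
rewrite -mulrA; apply: norm_sin_pi_ge => k.
have pq2 : (2 * p, 2 * q) <> (0, 0).
  by move=> [/eqP + /eqP]; rewrite !mulf_eq0/= => /eqP p0 /eqP q0; apply: pq; rewrite p0 q0.
have := H (2 * p) (2 * q) (- k) pq2; rewrite [(- k)%:~R]mulrNz.
apply: le_trans; set m := Num.max _ _.
have m1 : 1 <= m.
  rewrite /m le_max; case: (eqVneq p 0) => [p0|p0].
    have q0 : q != 0 by apply/eqP => q0; apply: pq; rewrite p0 q0.
    by apply/orP; right; rewrite -gtz0_ge1 normr_gt0 mulf_neq0.
  by apply/orP; left; rewrite -gtz0_ge1 normr_gt0 mulf_neq0.
have mn : m <= (2 * n)%N%:Z.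
  rewrite /m ge_max !normrM /= PoszM !ler_pM2l// -!abszE !lez_nat.
  by rewrite pn qn.
have mR1 : 1 <= m%:~R :> R by rewrite ler1z.
have mRn : m%:~R <= (2 * n)%N%:R :> R by have := mn; rewrite -(ler_int R).
rewrite -mulrA -invfM -exprMn; apply: ler_wpM2l; first exact: ltW.
rewrite lef_pV2 ?posrE ?powR_gt0 ?exprn_gt0 ?mulr_gt0 ?ltr0n//; last by lra.
apply: (@le_trans _ _ (m%:~R `^ L%:R)); first exact: ler_powR.
rewrite powR_mulrn; last by lra.
by apply: lerXn2r; rewrite ?nnegrE -?natrM//; lra.
Qed.

Definition expi (R : realType) (s : R) : R[i] :=
  Complex (cos (2 * pi * s)) (sin (2 * pi * s)).

Lemma expiD (R : realType) (s t : R) : expi (s + t) = expi s * expi t.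
Proof.
rewrite /expi mulrDr cosD sinD; apply/eqP; rewrite eq_complex /=.
by rewrite eqxx/= addrC.
Qed.

Lemma expi0 (R : realType) : expi (0 : R) = 1.
Proof. by rewrite /expi mulr0 cos0 sin0. Qed.

Lemma normc_expi (R : realType) (s : R) : normc (expi s) = 1.
Proof. by rewrite /= cos2Dsin2 sqrtr1. Qed.

Lemma expi_mulrn (R : realType) (s : R) (n : nat) : expi s ^+ n = expi (n%:R * s).
Proof.
elim: n => [|n IH]; first by rewrite expr0 mul0r expi0.
by rewrite exprS IH -expiD -natr1 mulrDl mul1r addrC.
Qed.

Lemma normc_real (R : rcfType) (r : R) : normc (r%:C)%C = `|r|.
Proof. by rewrite /= expr0n addr0 sqrtr_sqr. Qed.

Lemma normcJ (R : rcfType) (z : R[i]) : normc (z^*)%C = normc z.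
Proof. by case: z => a b /=; rewrite sqrrN. Qed.

Lemma expiJ (R : realType) (s : R) : ((expi s)^*)%C = expi (- s).
Proof. by rewrite /expi/= mulrN cosN sinN. Qed.

Lemma im_realM (R : rcfType) (r : R) (z : R[i]) : im ((r%:C)%C * z) = r * im z.
Proof. by case: z => a b /=; rewrite mul0r addr0. Qed.

Lemma realcX (R : rcfType) (r : R) (n : nat) : ((r%:C)%C : R[i]) ^+ n = ((r ^+ n)%:C)%C.
Proof. by rewrite rmorphXn. Qed.

(* The sine of the angle between [z] and [w] controls their distance. *)
Lemma normc_sub_ge_im (R : rcfType) (z w : R[i]) :
  `|im (z * (w^*)%C)| <= normc (z - w) * normc w.
Proof.
rewrite -[normc w]normcJ -normcM; apply: le_trans (im_le_normc _).
case: z w => [a b] [c d] /=; rewrite le_eqVlt; apply/orP; left; apply/eqP.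
by congr (`| _ |); ring.
Qed.

(** The product of [Z] and the conjugate of [Z'] is a real number times [expi al]. The sine of the
    angle between the two points is therefore [sin (2 pi al)] up to sign, whatever the sizes and
    signs of [ra] and [rb]. *)
Lemma diophantine_separated (R : realType) (ra rb ta tb : R) :
  ra != 0 -> rb != 0 -> diophantine_pair ta tb ->
  powers_separated ((ra%:C)%C * expi ta) ((rb%:C)%C * expi tb).
Proof.
move=> ra0 rb0 /diophantine_sin[c [L [c0 H]]]; exists c, L; split => //.
move=> n i j i' j' z n0 iN jN i'N j'N ij.
have [->|z0] := eqVneq z 0; first by rewrite !mulr0 subrr normc0 mulr0.
set mu := _ * expi ta; set nu := _ * expi tb.
set Z := mu ^+ i * _; set Z' := mu ^+ i' * _.
have nzr (r s : R) : r != 0 -> (r%:C)%C * expi s != 0.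
  by move=> r0; rewrite -normc_gt0 normcM normc_expi mulr1 normc_real normr_gt0.
have Z'0 : 0 < normc Z' by rewrite normc_gt0 !mulf_neq0 ?expf_neq0 ?nzr.
pose rho := ra ^+ i * rb ^+ j * (ra ^+ i' * rb ^+ j') * normc z ^+ 2.
pose al := (i%:R - i'%:R) * ta + (j%:R - j'%:R) * tb.
have zz : z * (z^*)%C = ((normc z ^+ 2)%:C)%C.
  rewrite normc_sqr; case: (z) => a b; apply/eqP; rewrite eq_complex /=.
  by apply/andP; split; apply/eqP; ring.
have E : Z * (Z'^*)%C = (rho%:C)%C * expi al.
  have cM (x y : R[i]) : ((x * y)^*)%C = (x^*)%C * (y^*)%C by exact: rmorphM.
  have cX (x : R[i]) m : ((x ^+ m)^*)%C = (x^*)%C ^+ m by exact: rmorphXn.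
  rewrite /Z /Z' /mu /nu !cM !cX !cM !exprMn !expiJ !conjc_real.
  have rM (x y : R) : ((x * y)%:C)%C = (x%:C)%C * (y%:C)%C :> R[i] by exact: rmorphM.
  rewrite !expi_mulrn !realcX /rho /al; move: (normc z ^+ 2) zz => N2 zz.
  rewrite !rM -zz.
  have -> : (i%:R - i'%:R) * ta + (j%:R - j'%:R) * tb =
     i%:R * ta + j%:R * tb + (i'%:R * (- ta) + j'%:R * (- tb)) by ring.
  rewrite !expiD; ring.
have nE : `|rho| = normc Z * normc Z'.
  by rewrite -[normc Z']normcJ -normcM E normcM normc_expi mulr1 normc_real.
have := normc_sub_ge_im Z Z'; rewrite E im_realM normrM nE mulrAC.
rewrite ler_pM2r// => h; apply: le_trans h; rewrite mulrC.
apply: ler_wpM2l; first exact: normc_ge0.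
have := H n (i%:Z - i'%:Z) (j%:Z - j'%:Z) n0.
rewrite !rmorphB /= -!pmulrn -/al; apply.
- by clear -iN i'N; lia.
- by clear -jN j'N; lia.
- move=> [e1 e2]; move/eqP: ij; apply; congr (_, _).
  + by clear -e1; lia.
  + by clear -e2; lia.
Qed.

(** Cosines near [1] in absolute value force small sines, so the addition formula makes
    [sin (pi (y - y'))] small; distance at most one half allows the sine to be inverted. *)
Lemma cos_pi_rigid (R : realType) (gam y y' : R) : 0 <= gam ->
  gam < `|cos (pi * y)| -> gam < `|cos (pi * y')| -> `|y - y'| <= 2^-1 ->
  (cos 1 ^+ 2 * `|y - y'|) ^+ 2 <= 4 * (1 - gam ^+ 2).
Proof.
move=> g0 hy hy' d2; have hs := norm_sin_pi d2.
have sb (x : R) : gam < `|cos (pi * x)| -> sin (pi * x) ^+ 2 <= 1 - gam ^+ 2.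
  move=> hx; have := cos2Dsin2 (pi * x).
  have : gam ^+ 2 <= cos (pi * x) ^+ 2.
    by rewrite -[leRHS]real_normK ?num_real//; apply: lerXn2r; rewrite ?nnegrE// ltW.
  lra.
apply: (@le_trans _ _ (`|sin (pi * (y - y'))| ^+ 2)).
  by apply: lerXn2r; rewrite ?nnegrE// mulr_ge0 ?sqr_ge0.
rewrite real_normK ?num_real// mulrBr sinB.
have := sb _ hy; have := sb _ hy'.
have := cos2Dsin2 (pi * y); have := cos2Dsin2 (pi * y').
set s := sin _; set s' := sin _; set k := cos _; set k' := cos _ => e e' h h'.
have k1 : k ^+ 2 <= 1 by have := sqr_ge0 s; lra.
have k1' : k' ^+ 2 <= 1 by have := sqr_ge0 s'; lra.
have a1 : (s * k') ^+ 2 <= s ^+ 2 by rewrite exprMn ler_piMr ?sqr_ge0.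
have a2 : (k * s') ^+ 2 <= s' ^+ 2 by rewrite exprMn ler_piMl ?sqr_ge0.
have := sqr_ge0 (s * k' + k * s').
nra.
Qed.

(** For [rho] not real, [re w] and [re (rho * w)] determine [w]: [im rho * im w = re rho * re w - re
    (rho * w)]. *)
Lemma normc_le_two_re (R : rcfType) (rho w : R[i]) (e : R) :
  `|re w| <= e -> `|re (rho * w)| <= e ->
  `|im rho| * normc w <= (`|im rho| + `|re rho| + 1) * e.
Proof.
move=> h1 h2; apply: (@le_trans _ _ (`|im rho| * `|re w| + `|im rho * im w|)).
  by rewrite normrM -mulrDr; apply: ler_wpM2l => //; exact: normc_le_reim.
have h3 : `|im rho * im w| <= `|re rho| * e + e.
  have -> : im rho * im w = re rho * re w - re (rho * w).
    by case: (rho) (w) => [a b] [c d] /=; ring.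
  apply: le_trans (ler_normB _ _) _; rewrite normrM; apply: lerD => //.
  exact: ler_wpM2l.
have h4 : `|im rho| * `|re w| <= `|im rho| * e by exact: ler_wpM2l.
by rewrite !mulrDl mul1r; lra.
Qed.

(** One cosine controls a single real direction of [z - z']; the second, rotated by [rho], supplies
    another. The radius is such that [(z - z') * d] and its product with [rho] have modulus at most
    one half. *)
Lemma cos_gain_rigid (R : realType) (d rho : R[i]) : d != 0 -> im rho != 0 ->
  rigid_gain (fun z : R[i] =>
    `|cos (pi * re (z * d))| * `|cos (pi * re (rho * z * d))|).
Proof.
move=> d0 rho0; set g := fun z => _.
have nd : 0 < normc d by rewrite normc_gt0.
have ir : 0 < `|im rho| by rewrite normr_gt0.
have rn0 : rho != 0 by apply: contra rho0 => /eqP ->.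
have nr : 0 < normc rho by rewrite normc_gt0.
have c1 : 0 < cos (1 : R) by exact: cos1_gt0.
pose K := 1 + normc rho.
have K0 : 0 < K by rewrite /K addr_gt0.
pose M := `|im rho| + `|re rho| + 1.
have M0 : 0 < M by rewrite /M ltr_wpDl ?addr_ge0.
exists ((2 * K * normc d)^-1); first by rewrite invr_gt0 !mulr_gt0.
move=> eta eta0.
pose e := eta * normc d * `|im rho| / M.
have e0 : 0 < e by rewrite divr_gt0 ?mulr_gt0.
pose t := Num.min ((cos 1 ^+ 2 * e) ^+ 2 / 4) 1.
have ce0 : 0 < cos 1 ^+ 2 * e by rewrite mulr_gt0// exprn_gt0.
have t0 : 0 < t by rewrite /t lt_min ltr01 andbT divr_gt0// exprn_gt0.
have t1 : t <= 1 by rewrite ge_min lexx orbT.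
pose gam := Num.sqrt (1 - t).
have gam0 : 0 <= gam by exact: sqrtr_ge0.
have gam2 : gam ^+ 2 = 1 - t by rewrite sqr_sqrtr// subr_ge0.
exists gam; split=> //.
  by rewrite -[ltRHS]sqrtr1 ltr_sqrt// ltrBlDr ltrDl.
move=> z z'; rewrite /g => hz hz' zz'.
have cm (x : R) : `|cos x| <= 1 by exact: cos_max.
have hl (a b : R) : gam < `|a| * `|b| -> `|a| <= 1 -> `|b| <= 1 -> gam < `|a| /\ gam < `|b|.
  move=> h ha hb; split; apply: (lt_le_trans h); first exact: ler_piMr.
  exact: ler_piMl.
have [h1 h2] := hl _ _ hz (cm _) (cm _); have [h1' h2'] := hl _ _ hz' (cm _) (cm _).
have step (u u' : R[i]) : gam < `|cos (pi * re u)| -> gam < `|cos (pi * re u')| ->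
    normc (u - u') <= 2^-1 -> `|re (u - u')| <= e.
  move=> hu hu' uu'.
  have re_sub : re (u - u') = re u - re u' by case: (u) (u') => [? ?] [? ?].
  have := cos_pi_rigid gam0 hu hu'; rewrite -re_sub => /(_ (le_trans (re_le_normc _) uu')).
  rewrite gam2 (_ : 1 - (1 - t) = t); last by ring.
  move=> h; have : (cos 1 ^+ 2 * `|re (u - u')|) ^+ 2 <= (cos 1 ^+ 2 * e) ^+ 2.
    apply: (le_trans h); have : t <= (cos 1 ^+ 2 * e) ^+ 2 / 4 by rewrite ge_min lexx.
    lra.
  have cn0 : 0 <= cos 1 ^+ 2 * `|re (u - u')| by rewrite mulr_ge0 ?sqr_ge0.
  by rewrite ler_pXn2r ?nnegrE ?(ltW ce0)// ler_pM2l ?exprn_gt0.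
have dz : normc ((z - z') * d) <= (2 * K)^-1.
  rewrite normcM; apply: (le_trans (ler_wpM2r (ltW nd) zz')).
  by rewrite invfM divfK// gt_eqF.
have K1 : (2 * K)^-1 <= 2^-1.
  by rewrite lef_pV2 ?posrE ?mulr_gt0// ler_peMr// /K lerDl ltW.
have w1 : `|re ((z - z') * d)| <= e.
  rewrite mulrBl; apply: step => //; rewrite -mulrBl; exact: le_trans K1.
have w2 : `|re (rho * ((z - z') * d))| <= e.
  have -> : rho * ((z - z') * d) = rho * z * d - rho * z' * d by ring.
  apply: step => //.
  have -> : rho * z * d - rho * z' * d = rho * ((z - z') * d) by ring.
  rewrite normcM; apply: (le_trans (ler_wpM2l (ltW nr) dz)).
  rewrite invfM mulrCA ler_piMr ?invr_ge0// ler_pdivrMr// mul1r /K.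
  by rewrite lerDr.
have := normc_le_two_re w1 w2; rewrite -/M normcM.
rewrite /e => h; rewrite -(ler_pM2r nd) -(ler_pM2l ir).
apply: (le_trans h); rewrite le_eqVlt; apply/orP; left; apply/eqP.
by field; rewrite gt_eqF.
Qed.

(** * Integration against a self-similar measure *)

Local Open Scope classical_set_scope.
Local Open Scope ring_scope.

Lemma bounded_integrable (d : measure_display) (T : measurableType d) (R : realType)
    (mu : probability T R) (f : T -> R) (M : R) :
  measurable_fun setT f -> (forall x, `|f x| <= M) ->
  mu.-integrable setT (EFin \o f).
Proof.
move=> mf fM; apply: measurable_bounded_integrable => //.
  by rewrite (_ : _ setT = 1%E) ?ltry//; exact: probability_setT.
exists M; split; first exact: num_real.
by move=> y My x _; apply: le_trans (fM x) (ltW My).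
Qed.

(** For nonnegative functions one integrates against a finite sum of scaled pushforwards; a bounded
    [f] is first shifted by [M]. *)
Lemma Rintegral_mixture (d : measure_display) (T : measurableType d) (R : realType)
    (mu : probability T R) (A : finType) (p : A -> R) (phi : A -> T -> T)
    (f : T -> R) (M : R) :
  (forall a, 0 < p a) -> \sum_a p a = 1 ->
  (forall a, measurable_fun setT (phi a)) ->
  (forall B, measurable B ->
     mu B = (\sum_a (p a)%:E * pushforward mu (phi a) B)%E) ->
  measurable_fun setT f -> (forall x, `|f x| <= M) ->
  \int[mu]_x f x = \sum_a p a * \int[mu]_x f (phi a x).
Proof.
move=> p0 p1 mphi muE mf fM.
have [a0 _] : exists a : A, true.
  case: (pickP (fun a : A => true)) => [a _|A0]; first by exists a.
  by have := p1; rewrite big_pred0// => /esym/eqP; rewrite oner_eq0.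
have p0' a : 0 <= p a by exact: ltW.
pose b (k : nat) := nth a0 (enum A) k.
pose m_ (k : nat) : {measure set T -> \bar R} :=
  mscale (NngNum (p0' (b k)))
    (measure_function_pushforward__canonical__measure_function_Measure mu (mphi (b k))).
have sumE (V : nmodType) (F : A -> V) : \sum_(k < #|A|) F (b k) = \sum_a F a.
  by rewrite [RHS](big_enum_val (A := A)) /=; apply: eq_bigr => k _; rewrite (enum_val_nth a0).
have ge0 (g : T -> R) : (forall x, 0 <= g x) -> measurable_fun setT g ->
    (\int[mu]_x (g x)%:E = \sum_a (p a)%:E * \int[mu]_x (g (phi a x))%:E)%E.
  move=> g0 mg; have /measurable_EFinP mg' := mg.
  rewrite (eq_measure_integral (msum m_ #|A|)) => [|B mB _]; last first.
    by etransitivity; [exact: muE | rewrite /msum -sumE].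
  rewrite ge0_integral_measure_sum//; last by move=> x _; rewrite lee_fin.
  rewrite -sumE; apply: eq_bigr => k _.
  rewrite ge0_integral_mscale//=; last by move=> x _; rewrite lee_fin.
  congr (_ * _)%E.
  rewrite ge0_integral_pushforward//=.
  by move=> x _; rewrite lee_fin.
have fi : mu.-integrable setT (EFin \o f) by exact: bounded_integrable fM.
have mfp a : measurable_fun setT (f \o phi a) by exact: measurableT_comp.
have fpi a : mu.-integrable setT (EFin \o (f \o phi a)).
  by apply: bounded_integrable (mfp a) _ => x; exact: fM.
have Mi : mu.-integrable setT (EFin \o cst M).
  by apply: (@bounded_integrable _ _ _ _ _ `|M|).
have IM : \int[mu]_x M = M by rewrite Rintegral_cst// [X in fine X](_ : _ = 1%E) ?mulr1//; exact: probability_setT.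
have g0 x : 0 <= f x + M by have := fM x; rewrite ler_norml => /andP[]; lra.
have mfM : measurable_fun setT (fun x => f x + M) by exact: measurable_funD.
have := congr1 fine (ge0 _ g0 mfM).
rewrite -/(Rintegral mu setT (fun x => f x + M)) RintegralD// IM => h.
rewrite -[LHS](addrK M) h.
have -> : (\sum_a (p a)%:E * \int[mu]_x (f (phi a x) + M)%:E)%E =
    (\sum_a p a * (\int[mu]_x f (phi a x) + M))%:E.
  rewrite -sumEFin; apply: eq_bigr => a _.
  rewrite EFinM; congr (_ * _)%E.
  have -> : \int[mu]_x f (phi a x) + M = \int[mu]_x (f (phi a x) + M).
    have := @RintegralD _ _ _ mu setT (f \o phi a) (cst M) measurableT (fpi a) Mi.
    by rewrite /= IM => ->.
  rewrite /Rintegral fineK//.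
  apply: integrable_fin_num => //.
  apply: (@bounded_integrable _ _ _ _ _ (M + `|M|)).
    by apply: measurable_funD => //; exact: mfp.
  by move=> x; apply: le_trans (ler_normD _ _) _; rewrite lerD2r.
rewrite /=; under eq_bigr do rewrite mulrDr.
by rewrite big_split/= -mulr_suml p1 mul1r addrK.
Qed.

(** * The Fourier transform *)

(* With [z = xi.1 - i xi.2] and the plane identified with the complex numbers,
   [<xi, x> = re (z * x)], so that similarities act on [z] by multiplication. *)
Definition cplx (R : realType) (x : R * R) : R[i] := Complex x.1 x.2.

Definition frequency (R : realType) (z : R[i]) : R * R := (re z, - im z).

Definition fourierc (R : realType) (mu : probability (R * R)%type R) (z : R[i]) : R[i] :=
  fourier mu (frequency z).

Lemma dotp_frequency (R : realType) (z : R[i]) (x : R * R) :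
  dotp (frequency z) x = re (z * cplx x).
Proof. by case: z => a b; rewrite /dotp /= mulNr. Qed.

Lemma measurable_dotp (R : realType) (xi : R * R) :
  measurable_fun setT (dotp xi).
Proof.
by apply: measurable_funD; apply: measurable_funM.
Qed.

Lemma measurable_ifs_map (R : realType) (A : finType) (Phi : similarity_ifs R A) (a : A) :
  measurable_fun setT (ifs_map Phi a).
Proof.
apply: measurable_fun_pair => /=.
all: apply: measurable_funD => //; apply: measurable_funM => //.
all: by apply: measurable_funD; apply: measurable_funM.
Qed.

Lemma measurable_cos_dotp (R : realType) (s t : R) (xi : R * R) :
  measurable_fun setT (fun x => cos (s + t * dotp xi x)).
Proof.
apply: (measurableT_comp (continuous_measurable_fun (@continuous_cos R))).
apply: measurable_funD => //; apply: measurable_funM => //.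
exact: measurable_dotp.
Qed.

Lemma measurable_sin_dotp (R : realType) (s t : R) (xi : R * R) :
  measurable_fun setT (fun x => sin (s + t * dotp xi x)).
Proof.
apply: (measurableT_comp (continuous_measurable_fun (@continuous_sin R))).
apply: measurable_funD => //; apply: measurable_funM => //.
exact: measurable_dotp.
Qed.

(** With [c] and [s] the two integrals, [c ^ 2 + s ^ 2] is the integral of [c C + s S], which is
    pointwise at most [(c ^ 2 + s ^ 2 + 1) / 2] because [C ^ 2 + S ^ 2 = 1]. *)
Lemma normc_fourier_le1 (R : realType) (mu : probability (R * R)%type R) (xi : R * R) :
  normc (fourier mu xi) <= 1.
Proof.
rewrite -(@ler_pXn2r _ 2)// ?nnegrE ?normc_ge0// normc_sqr expr1n /=.
set c := \int[mu]_x _; set s := \int[mu]_x _.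
pose C x := cos (0 + 2 * pi * dotp xi x); pose S x := sin (0 + 2 * pi * dotp xi x).
have iC : mu.-integrable setT (EFin \o C).
  apply: (@bounded_integrable _ _ _ _ _ 1); first exact: measurable_cos_dotp.
  by move=> x; exact: cos_max.
have iS : mu.-integrable setT (EFin \o S).
  apply: (@bounded_integrable _ _ _ _ _ 1); first exact: measurable_sin_dotp.
  by move=> x; exact: sin_max.
have cE : c = \int[mu]_x C x by apply: eq_Rintegral => x _; rewrite /C add0r.
have sE : s = \int[mu]_x S x by apply: eq_Rintegral => x _; rewrite /S add0r.
have icC : mu.-integrable setT (EFin \o (fun x => c * C x)).
  by apply: eq_integrable (integrableZl measurableT c iC) => // x _; rewrite /= EFinM.
have isS : mu.-integrable setT (EFin \o (fun x => s * S x)).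
  by apply: eq_integrable (integrableZl measurableT s iS) => // x _; rewrite /= EFinM.
have E : c ^+ 2 + s ^+ 2 = \int[mu]_x (c * C x + s * S x).
  rewrite RintegralD// !RintegralZl// -cE -sE; ring.
have K : c ^+ 2 + s ^+ 2 <= (c ^+ 2 + s ^+ 2 + 1) / 2.
  set M := (_ + 1) / 2.
  have IM : \int[mu]_x M = M.
    by rewrite Rintegral_cst// [X in fine X](_ : _ = 1%E) ?mulr1//; exact: probability_setT.
  rewrite {1}E -[leRHS]IM; apply: le_Rintegral => //.
  - apply: eq_integrable (integrableD measurableT icC isS) => // x _.
  - apply: (@bounded_integrable _ _ _ _ _ `|M|) => //.
  move=> x _; rewrite /M; have := cos2Dsin2 (0 + 2 * pi * dotp xi x).
  rewrite -/(C x) -/(S x); have := sqr_ge0 (c - C x); have := sqr_ge0 (s - S x).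
  rewrite !sqrrB; lra.
lra.
Qed.

Lemma sum_complex (R : rcfType) (I : finType) (f g : I -> R) :
  Complex (\sum_i f i) (\sum_i g i) = \sum_i Complex (f i) (g i) :> R[i].
Proof.
by apply: (big_ind3 (fun a b (c : R[i]) => Complex a b = c)) => // a b c a' b' c' <- <-.
Qed.

Definition multiplier (R : realType) (A : finType) (Phi : similarity_ifs R A)
    (theta : A -> R) (a : A) : R[i] := (((Defs.ratio Phi a)%:C)%C * expi (theta a)).

Lemma cplx_ifs_map (R : realType) (A : finType) (Phi : similarity_ifs R A)
    (theta : A -> R) (a : A) (x : R * R) :
  rotation_angle (linear_part Phi a) (theta a) ->
  cplx (ifs_map Phi a x) = multiplier Phi theta a * cplx x + cplx (translation Phi a).
Proof.
move=> [_ rotE]; apply/eqP; rewrite eq_complex; apply/andP; split; apply/eqP.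
all: rewrite /ifs_map /affine_map /apply_mx rotE /multiplier /cplx /= !mxE /=; ring.
Qed.

Lemma fourierc_self_similar (R : realType) (A : finType) (Phi : similarity_ifs R A)
    (theta : A -> R) (mu : probability (R * R)%type R) (p : A -> R) (z : R[i]) :
  (forall a, rotation_angle (linear_part Phi a) (theta a)) ->
  (forall a, 0 < p a) -> \sum_a p a = 1 ->
  (forall B, measurable B ->
     mu B = (\sum_a (p a)%:E * pushforward mu (ifs_map Phi a) B)%E) ->
  fourierc mu z = \sum_a ((p a)%:C)%C *
    (expi (re (z * cplx (translation Phi a))) * fourierc mu (multiplier Phi theta a * z)).
Proof.
move=> rot p0 p1 muE.
pose ph a := re (z * cplx (translation Phi a)).
pose w a := multiplier Phi theta a * z.
have phase a x : dotp (frequency z) (ifs_map Phi a x) = ph a + dotp (frequency (w a)) x.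
  rewrite !dotp_frequency (cplx_ifs_map x (rot a)) /ph /w.
  rewrite mulrDr [z * (_ * _)]mulrCA mulrA addrC.
  by case: (z * cplx _) (_ * z * cplx x) => [? ?] [? ?].
have iC (s : R) (xi : R * R) : mu.-integrable setT (EFin \o (fun x => cos (s + 2 * pi * dotp xi x))).
  apply: (@bounded_integrable _ _ _ _ _ 1); first exact: measurable_cos_dotp.
  by move=> x; exact: cos_max.
have iS (s : R) (xi : R * R) : mu.-integrable setT (EFin \o (fun x => sin (s + 2 * pi * dotp xi x))).
  apply: (@bounded_integrable _ _ _ _ _ 1); first exact: measurable_sin_dotp.
  by move=> x; exact: sin_max.
have iC0 (xi : R * R) : mu.-integrable setT (EFin \o (fun x => cos (2 * pi * dotp xi x))).
  by apply: eq_integrable (iC 0 xi) => // x _; rewrite /= add0r.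
have iS0 (xi : R * R) : mu.-integrable setT (EFin \o (fun x => sin (2 * pi * dotp xi x))).
  by apply: eq_integrable (iS 0 xi) => // x _; rewrite /= add0r.
have iZ (c : R) f : mu.-integrable setT (EFin \o f) ->
    mu.-integrable setT (EFin \o (fun x => c * f x)).
  by move=> If; apply: eq_integrable (integrableZl measurableT c If) => // x _; rewrite /= EFinM.
have mC0 xi : measurable_fun setT (fun x : R * R => cos (2 * pi * dotp xi x)).
  by have := measurable_cos_dotp 0 (2 * pi) xi; under eq_fun do rewrite add0r.
have mS0 xi : measurable_fun setT (fun x : R * R => sin (2 * pi * dotp xi x)).
  by have := measurable_sin_dotp 0 (2 * pi) xi; under eq_fun do rewrite add0r.
rewrite /fourierc /fourier.
rewrite (Rintegral_mixture p0 p1 (measurable_ifs_map Phi) muE (mC0 _) (fun x => cos_max _)).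
rewrite (Rintegral_mixture p0 p1 (measurable_ifs_map Phi) muE (mS0 _) (fun x => sin_max _)).
rewrite sum_complex; apply: eq_bigr => a _; rewrite -/(ph a) -/(w a).
have -> : \int[mu]_x cos (2 * pi * dotp (frequency z) (ifs_map Phi a x)) =
    cos (2 * pi * ph a) * \int[mu]_x cos (2 * pi * dotp (frequency (w a)) x) -
    sin (2 * pi * ph a) * \int[mu]_x sin (2 * pi * dotp (frequency (w a)) x).
  rewrite -!RintegralZl// -RintegralB//; last 2 first.
  - exact: iZ.
  - exact: iZ.
  by apply: eq_Rintegral => x _; rewrite phase mulrDr cosD.
have -> : \int[mu]_x sin (2 * pi * dotp (frequency z) (ifs_map Phi a x)) =
    sin (2 * pi * ph a) * \int[mu]_x cos (2 * pi * dotp (frequency (w a)) x) +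
    cos (2 * pi * ph a) * \int[mu]_x sin (2 * pi * dotp (frequency (w a)) x).
  rewrite -!RintegralZl// -RintegralD//; last 2 first.
  - exact: iZ.
  - exact: iZ.
  by apply: eq_Rintegral => x _; rewrite phase mulrDr sinD.
by apply/eqP; rewrite eq_complex /expi /=; apply/andP; split; apply/eqP; ring.
Qed.

Lemma normc_sum_le (R : rcfType) (I : finType) (P : pred I) (f : I -> R[i]) :
  normc (\sum_(i | P i) f i) <= \sum_(i | P i) normc (f i).
Proof.
apply: (big_ind2 (fun (a : R[i]) b => normc a <= b)) => //; first by rewrite normc0.
by move=> a b c d ab cd; apply: le_trans (le_normcD _ _) _; exact: lerD.
Qed.

Lemma normc_expiD (R : realType) (u v : R) :
  normc (expi u + expi v) = 2 * `|cos (pi * (u - v))|.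
Proof.
apply/eqP; rewrite -(@eqrXn2 _ 2)// ?normc_ge0 ?mulr_ge0//; apply/eqP.
rewrite normc_sqr /= exprMn real_normK ?num_real//.
have h : cos (2 * pi * u - 2 * pi * v) = cos (pi * (u - v)) ^+ 2 *+ 2 - 1.
  by rewrite -cos_mulr2n -mulr_natl; congr cos; ring.
have e1 := cos2Dsin2 (2 * pi * u); have e2 := cos2Dsin2 (2 * pi * v).
have -> : (cos (2 * pi * u) + cos (2 * pi * v)) ^+ 2 +
    (sin (2 * pi * u) + sin (2 * pi * v)) ^+ 2 =
    (cos (2 * pi * u) ^+ 2 + sin (2 * pi * u) ^+ 2) +
    (cos (2 * pi * v) ^+ 2 + sin (2 * pi * v) ^+ 2) +
    2 * cos (2 * pi * u - 2 * pi * v) by rewrite cosB; ring.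
by rewrite e1 e2 h; ring.
Qed.

(** * Cancellation between words of length two *)

Definition self_similar_equation (R : realType) (A : finType) (p : A -> R)
    (lam t : A -> R[i]) (F : R[i] -> R[i]) : Prop :=
  forall z, F z = \sum_a ((p a)%:C)%C * (expi (re (z * t a)) * F (lam a * z)).

Lemma self_similar_submean (R : realType) (A : finType) (p : A -> R)
    (lam t : A -> R[i]) (F : R[i] -> R[i]) :
  (forall a, 0 < p a) -> self_similar_equation p lam t F ->
  submean p lam (fun z => normc (F z)).
Proof.
move=> p0 FE z; rewrite FE; apply: le_trans (normc_sum_le _ _) _.
apply: ler_sum => a _; rewrite !normcM normc_real normc_expi mul1r.
by rewrite ger0_norm ?(ltW (p0 a)).
Qed.

Definition swapped (A : finType) (x y : A) (w : A * A) : bool :=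
  (w == (x, y)) || (w == (y, x)).

Lemma big_swapped (V : nmodType) (A : finType) (x y : A) (f : A * A -> V) : x != y ->
  \sum_w f w = f (x, y) + f (y, x) + \sum_(w | ~~ swapped x y w) f w.
Proof.
move=> xy; rewrite (bigD1 (x, y))//= (bigD1 (y, x))/=; last first.
  by rewrite xpair_eqE negb_and eq_sym xy.
by rewrite addrA; congr (_ + _); apply: eq_bigl => w; rewrite /swapped negb_or.
Qed.

(* The words [x y] and [y x] have the same multiplier but translations
   differing by [d], whence the factor [cos (pi re (z d))]. *)
Lemma swap_gain (R : realType) (A : finType) (p : A -> R)
    (lam t : A -> R[i]) (F : R[i] -> R[i]) (x y : A) :
  (forall a, 0 < p a) -> self_similar_equation p lam t F -> x != y ->
  gain_recursion (2 * p x * p y)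
    (fun z => `|cos (pi * re (z * (t x + lam x * t y - (t y + lam y * t x))))|)
    (lam x * lam y)
    (fun w => if swapped x y w then 0 else p w.1 * p w.2)
    (fun w => lam w.2 * lam w.1) (fun z => normc (F z)).
Proof.
move=> p0 FE xy z.
pose H (w : A * A) := ((p w.1)%:C)%C * (expi (re (z * t w.1)) *
   (((p w.2)%:C)%C * (expi (re (lam w.1 * z * t w.2)) * F (lam w.2 * (lam w.1 * z))))).
have FH : F z = \sum_w H w.
  rewrite FE -(pair_bigA _ (fun a b => H (a, b)))/=; apply: eq_bigr => a _.
  by rewrite FE !mulr_sumr.
rewrite FH (big_swapped _ xy); apply: le_trans (le_normcD _ _) _; apply: lerD; last first.
  apply: le_trans (normc_sum_le _ _) _; rewrite /avg big_mkcond/=.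
  apply: ler_sum => w _; case: ifP => /= [/negPf ->|/negbFE ->]; last by rewrite mul0r.
  rewrite /H !normcM !normc_real !normc_expi !mul1r !ger0_norm ?(ltW (p0 _))//.
  by rewrite !mulrA.
pose u := re (z * t x) + re (lam x * z * t y).
pose v := re (z * t y) + re (lam y * z * t x).
have HE : H (x, y) + H (y, x) = ((p x * p y)%:C)%C * ((expi u + expi v) * F (lam x * lam y * z)).
  rewrite /H /u /v /= !expiD rmorphM /=.
  have -> : lam y * (lam x * z) = lam x * lam y * z by ring.
  have -> : lam x * (lam y * z) = lam x * lam y * z by ring.
  ring.
rewrite HE !normcM normc_real normc_expiD ger0_norm ?mulr_ge0 ?(ltW (p0 _))//.
have -> : u - v = re (z * (t x + lam x * t y - (t y + lam y * t x))).
  rewrite /u /v; case: (z) (t x) (t y) (lam x) (lam y) => [z1 z2] [a1 a2] [b1 b2] [c1 c2] [d1 d2].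
  by rewrite /=; ring.
by rewrite le_eqVlt; apply/orP; left; apply/eqP; ring.
Qed.

(** The recursion is applied again to the gain term only. The new letters are the old ones and [kap]
    followed by an old one; on the latter the first gain is discarded by [g <= 1]. *)
Lemma gain_recursion_square (R : realType) (B : finType) (P : R) (g : R[i] -> R)
    (kap : R[i]) (p : B -> R) (lam : B -> R[i]) (G : R[i] -> R) :
  0 <= P -> (forall b, 0 <= p b) -> (forall z, 0 <= g z <= 1) -> (forall z, 0 <= G z) ->
  gain_recursion P g kap p lam G ->
  gain_recursion (P * P) (fun z => g z * g (kap * z)) (kap * kap)
    (fun w : B + B => match w with inl b => p b | inr b => P * p b end)
    (fun w : B + B => match w with inl b => lam b | inr b => lam b * kap end) G.
Proof.
move=> P0 p0 g01 G0 rec z; apply: (le_trans (rec z)).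
rewrite [X in _ <= _ + X]/avg big_sumType/= [leRHS]addrCA [leLHS]addrC; apply: lerD => //.
have /andP[g0 g1] := g01 z.
have h := ler_wpM2l P0 (ler_wpM2l g0 (rec (kap * z))).
apply: (le_trans h); rewrite !mulrDr; apply: lerD.
  by rewrite -[kap * kap * z]mulrA le_eqVlt; apply/orP; left; apply/eqP; ring.
have a0 : 0 <= avg p lam G (kap * z) by apply: sumr_ge0 => b _; rewrite mulr_ge0.
apply: (@le_trans _ _ (P * avg p lam G (kap * z))).
  by apply: ler_wpM2l => //; exact: ler_piMl.
rewrite /avg mulr_sumr; apply: ler_sum => b _.
by rewrite !mulrA.
Qed.

(** * Conclusion *)

Lemma ler_prod_factor (R : realDomainType) (A : finType) (f : A -> R) (a : A) :
  (forall c, 0 <= f c <= 1) -> \prod_c f c <= f a.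
Proof.
move=> f01; rewrite (bigD1 a)//=; have /andP[fa _] := f01 a.
by rewrite ler_piMr// prodr_ile1// => c _.
Qed.

(** The product of the values replaces their minimum, and [1 - \prod_c (1 - f c)] their maximum;
    both make sense for an empty [A]. *)
Lemma uniform_bounds (R : realDomainType) (A : finType) (f : A -> R) :
  (forall c, 0 < f c < 1) ->
  exists r0 r1 : R, [/\ 0 < r0, r1 < 1 & forall c, r0 <= f c <= r1].
Proof.
move=> f01; exists (\prod_c f c), (1 - \prod_c (1 - f c)); split.
- by apply: prodr_gt0 => c _; have /andP[] := f01 c.
- rewrite ltrBlDr ltrDl; apply: prodr_gt0 => c _.
  by have /andP[_ h] := f01 c; rewrite subr_gt0.
move=> c; apply/andP; split.
  by apply: ler_prod_factor => b; have /andP[/ltW h0 /ltW h1] := f01 b; rewrite h0.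
rewrite lerBrDr -lerBrDl; apply: ler_prod_factor => b.
by have /andP[/ltW h0 /ltW h1] := f01 b; apply/andP; split; lra.
Qed.

Lemma normcM_bounds (R : rcfType) (u v : R[i]) (a b r : R) :
  0 <= a -> 0 <= b -> r <= 1 -> a <= normc u <= r -> b <= normc v <= r ->
  a * b <= normc (u * v) <= r.
Proof.
move=> a0 b0 r1 /andP[au ur] /andP[bv vr]; rewrite normcM; apply/andP; split.
  exact: ler_pM.
apply: le_trans ur; rewrite ler_piMr ?normc_ge0//; exact: le_trans r1.
Qed.

(** The squared recursion has gain cosines at [z] and at [lam x * lam y * z], rigid since this
    multiplier is not real. Its words have at most four letters, whence the lower bound [r0 ^ 4]. *)
Lemma swap_flat (R : realType) (A : finType) (p : A -> R)
    (lam t : A -> R[i]) (F : R[i] -> R[i]) (x y : A) (r0 r1 : R) :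
  (forall a, 0 < p a) -> \sum_a p a = 1 -> self_similar_equation p lam t F ->
  (forall z, normc (F z) <= 1) ->
  0 < r0 -> r1 < 1 -> (forall a, r0 <= normc (lam a) <= r1) ->
  x != y -> t x + lam x * t y - (t y + lam y * t x) != 0 -> im (lam x * lam y) != 0 ->
  flat r1 (fun z => normc (F z)).
Proof.
move=> p0 p1 FE F1 r00 r11 lr xy d0 im0.
set d := t x + lam x * t y - (t y + lam y * t x) in d0.
pose G z := normc (F z); pose P := 2 * p x * p y.
pose p' (w : A * A) := if swapped x y w then 0 else p w.1 * p w.2.
pose lam' (w : A * A) := lam w.2 * lam w.1.
pose g (z : R[i]) := `|cos (pi * re (z * d))|.
have rec : gain_recursion P g (lam x * lam y) p' lam' G by exact: swap_gain.
have G0 z : 0 <= G z by exact: normc_ge0.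
have px := p0 x; have py := p0 y.
have P0 : 0 < P by rewrite !mulr_gt0.
have P12 : P <= 1 / 2.
  have : p x + p y <= 1.
    rewrite -p1 (bigD1 x)//= lerD2l (bigD1 y)/=; last by rewrite eq_sym.
    by rewrite lerDl sumr_ge0// => a _; exact: ltW.
  rewrite /P; have := sqr_ge0 (p x - p y); nra.
have p'0 w : 0 <= p' w by rewrite /p'; case: ifP => // _; rewrite mulr_ge0 ?ltW.
have Psum : P + \sum_w p' w = 1.
  have -> : \sum_w p' w = \sum_(w | ~~ swapped x y w) p w.1 * p w.2.
    by rewrite [RHS]big_mkcond; apply: eq_bigr => w _; rewrite /p'; case: ifP.
  have := big_swapped (fun w => p w.1 * p w.2) xy.
  rewrite -(pair_bigA _ (fun a b => p a * p b))/=.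
  under eq_bigr do rewrite -mulr_sumr p1 mulr1.
  by rewrite p1 /P => e; rewrite [RHS]e; ring.
have g01 z : 0 <= g z <= 1 by rewrite /g normr_ge0 cos_max.
have rec2 := gain_recursion_square (ltW P0) p'0 g01 G0 rec.
have r01 : r0 <= 1 by have /andP[h1 h2] := lr x; exact: le_trans (le_trans h1 h2) (ltW r11).
have r0' : 0 <= r0 by exact: ltW.
have b2 a b : r0 * r0 <= normc (lam a * lam b) <= r1 by apply: normcM_bounds => //; exact: ltW.
have b4 a b a' b' : (r0 * r0) * (r0 * r0) <= normc (lam a * lam b * (lam a' * lam b')) <= r1.
  by apply: normcM_bounds => //; rewrite ?mulr_ge0//; exact: ltW.
apply: (@gain_recursion_flat R _ _ _ _ _ _ _ (r0 * r0 * (r0 * r0)) r1 rec2).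
- by rewrite mulr_gt0.
- by nra.
- by case=> w //; rewrite mulr_ge0// ltW.
- rewrite big_sumType/= -mulr_sumr.
  have -> : \sum_w p' w = 1 - P by rewrite -Psum; ring.
  ring.
- move=> z; have /andP[a0 a1] := g01 z; have /andP[c0 c1] := g01 (lam x * lam y * z).
  by rewrite mulr_ge0//= mulr_ile1.
- by move=> z; rewrite G0 F1.
- by rewrite !mulr_gt0.
- by [].
- exact: b4.
- case=> w; last exact: b4.
  have /andP[h1 h2] := b2 w.2 w.1; rewrite h2 andbT; apply: le_trans h1.
  by rewrite ler_piMr ?mulr_ge0// mulr_ile1.
exact: cos_gain_rigid.
Qed.

(* [(1 - lam b) t a = (1 - lam a) t b] says that [f_a] and [f_b] have the same
   fixed point [t a / (1 - lam a)]. *)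
Lemma exists_swap_pair (R : realType) (A : finType) (lam t : A -> R[i]) (a b : A) :
  (forall c, normc (lam c) < 1) -> (forall c, lam c != 0) ->
  ~ (exists z, forall c, lam c * z + t c = z) ->
  im (lam a * lam b) != 0 -> im (lam a * ((lam b)^*)%C) != 0 ->
  exists x y : A, t x + lam x * t y - (t y + lam y * t x) != 0 /\ im (lam x * lam y) != 0.
Proof.
move=> l1 ln0 nofix im1 im2.
have n1 c : 1 - lam c != 0.
  rewrite subr_eq0; apply/eqP => e; have := l1 c.
  by rewrite -e normc1 ltxx.
pose d x y := t x + lam x * t y - (t y + lam y * t x).
have dE x y : d x y = (1 - lam y) * t x - (1 - lam x) * t y by rewrite /d; ring.
have [dab|dab] := eqVneq (d a b) 0; last by exists a, b.
(* Now [f_a] and [f_b] share their fixed point, and some [f_c] moves it; so [c] can be paired with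
   either of them. *)
have [c hc] : exists c, lam c * (t a / (1 - lam a)) + t c != t a / (1 - lam a).
  apply: contra_notP nofix => h; exists (t a / (1 - lam a)) => c.
  by apply: contra_notP h => hc; exists c; apply/eqP.
have dac : d a c != 0.
  apply: contra hc => /eqP; rewrite dE => /eqP; rewrite subr_eq0 => /eqP e.
  apply/eqP; apply: (mulfI (n1 a)).
  have -> : (1 - lam a) * (lam c * (t a / (1 - lam a)) + t c) =
     lam c * t a + (1 - lam a) * t c by field; exact: n1.
  rewrite -e; field; exact: n1.
have dbc : d b c != 0.
  apply: contra dac => /eqP; rewrite dE => /eqP; rewrite subr_eq0 => /eqP e.
  move: dab; rewrite dE => /eqP; rewrite subr_eq0 => /eqP e'.
  rewrite dE subr_eq0; apply/eqP; apply: (mulfI (n1 b)).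
  by rewrite mulrCA e' mulrCA e; ring.
have [iac|iac] := eqVneq (im (lam a * lam c)) 0; last by exists a, c.
have [ibc|ibc] := eqVneq (im (lam b * lam c)) 0; last by exists b, c.
(* If [lam a * lam c] and [lam b * lam c] were both real, so would be [normc (lam c) ^+ 2] times
   [lam a] times the conjugate of [lam b]. *)
exfalso; move/eqP: im2; apply.
have nc : normc (lam c) ^+ 2 != 0 by rewrite expf_neq0// gt_eqF// normc_gt0.
apply: (mulfI nc); rewrite mulr0 normc_sqr.
move: iac ibc; case: (lam a) (lam b) (lam c) => [a1 a2] [b1 b2] [c1 c2] /= iac ibc.
have -> : (c1 ^+ 2 + c2 ^+ 2) * (a1 * - b2 + a2 * b1) =
  (a1 * c2 + a2 * c1) * (b1 * c1 - b2 * c2) - (b1 * c2 + b2 * c1) * (a1 * c1 - a2 * c2) by ring.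
by rewrite iac ibc !mul0r subrr.
Qed.

(** The best [u] is the integer logarithm of [ln s / ln D] in base [2 ^ 16], and [kappa] solves
    [tau = 2 ^ (- 16 kappa)]; rounding [u] costs the factor [1 / tau]. *)
Lemma polylog_of_tower (R : realType) (K D tau : R) :
  0 <= K -> 1 < D -> 0 < tau -> tau < 1 ->
  exists2 kappa : R, 0 < kappa & exists C : R, forall s g : R, D <= s ->
    (forall u : nat, D ^+ (2 ^ (16 * u)) <= s -> g <= K * tau ^+ u) ->
    g <= C * ln s `^ (- kappa).
Proof.
move=> K0 D1 tau0 tau1.
have lD : 0 < ln D by rewrite ln_gt0.
have lt0 : ln tau < 0 by rewrite ln_lt0// tau0.
have l2 : 0 < ln (2 : R) by rewrite ln_gt0// ltr1n.
pose kappa := - ln tau / (16 * ln 2).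
have k0 : 0 < kappa by rewrite divr_gt0 ?mulr_gt0// oppr_gt0.
exists kappa => //; exists (K / tau * ln D `^ kappa) => s g Ds Hg.
have s0 : 0 < s by apply: lt_le_trans Ds; lra.
pose y := ln s / ln D.
have y1 : 1 <= y by rewrite ler_pdivlMr// mul1r ler_ln ?posrE//; lra.
have y0 : 0 < y by lra.
pose m := Num.truncn y.
have /andP[my ym] := truncn_itv (ltW y0); rewrite -/m in my ym.
have m0 : (0 < m)%N by rewrite truncn_gt0.
pose u := trunc_log (2 ^ 16) m.
have /andP[um mu] := trunc_log_bounds (isT : (1 < 2 ^ 16)%N) m0; rewrite -/u in um mu.
rewrite -!expnM in um mu.
have /Hg h : D ^+ (2 ^ (16 * u)) <= s.
  apply: (@le_trans _ _ (D ^+ m)); first by apply: ler_weXn2l => //; exact: ltW.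
  rewrite -ler_ln ?posrE ?exprn_gt0//; [|lra..].
  rewrite lnXn; last by lra.
  by rewrite -mulr_natl -ler_pdivlMr.
apply: (le_trans h).
have yu : y <= 2 ^+ (16 * u.+1).
  apply: (le_trans (ltW ym)); rewrite -natrX ler_nat.
  exact: mu.
have e : ln s = y * ln D by rewrite /y divfK// gt_eqF.
have sy : ln s `^ (- kappa) = y `^ (- kappa) * (ln D `^ kappa)^-1.
  by rewrite e powRM ?(ltW y0) ?(ltW lD)// !powRN.
rewrite sy.
have lDk : 0 < ln D `^ kappa by rewrite powR_gt0.
have -> : K / tau * ln D `^ kappa * (y `^ (- kappa) / ln D `^ kappa) = K / tau * y `^ (- kappa).
  by field; rewrite !gt_eqF.
have ty : tau ^+ u.+1 <= y `^ (- kappa).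
  have -> : tau ^+ u.+1 = (2 ^+ (16 * u.+1)) `^ (- kappa).
    rewrite -[LHS]lnK ?posrE ?exprn_gt0// lnXn// /powR gt_eqF ?exprn_gt0//.
    rewrite lnXn// /kappa; congr expR.
    rewrite -[ln tau *+ _]mulr_natl -[ln 2 *+ _]mulr_natl natrM; field.
    by rewrite gt_eqF.
  rewrite !powRN lef_pV2 ?posrE ?powR_gt0 ?exprn_gt0//.
  by apply: ge0_ler_powR; rewrite ?nnegrE ?exprn_ge0 ?(ltW k0) ?(ltW y0).
rewrite -mulrA; apply: ler_wpM2l => //.
by rewrite ler_pdivlMl// -exprS.
Qed.

Theorem theorem1p7 (R : realType) (A : finType) (Phi : similarity_ifs R A)
    (theta : A -> R)
    (hSO : forall a : A, special_orthogonal_group (linear_part Phi a))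
    (htheta : forall a : A, rotation_angle (linear_part Phi a) (theta a))
    (hdioph : exists a b : A, diophantine_pair (theta a) (theta b))
    (mu : probability (R * R)%type R) (hmu : self_similar_measure Phi mu) :
  polylog_fourier_decay mu.
Proof.
have [p [p0 p1 muE]] := hmu; have [a [b dab]] := hdioph.
pose lam := multiplier Phi theta; pose t c := cplx (translation Phi c).
pose F := fourierc mu.
have FE : self_similar_equation p lam t F.
  by move=> z; exact: fourierc_self_similar.
have F1 z : normc (F z) <= 1 by exact: normc_fourier_le1.
have nlam c : normc (lam c) = `|Defs.ratio Phi c|.
  by rewrite normcM normc_real normc_expi mulr1.
have rb := ratio_bounds Phi.
have rn0 c : Defs.ratio Phi c != 0 by rewrite -normr_gt0; have /andP[] := rb c.
have [r0 [r1 [r00 r11 lr']]] := uniform_bounds rb.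
have lr c : r0 <= normc (lam c) <= r1 by rewrite nlam.
have l1 c : normc (lam c) < 1 by rewrite nlam; have /andP[] := rb c.
have ln0 c : lam c != 0 by rewrite -normc_gt0 nlam; have /andP[] := rb c.
(* The qualitative content of the condition: [(1, -1)] shows [a != b], while [(1, 1)] and [(1, -1)]
   show that [lam a] times [lam b], and times its conjugate, is not real. *)
have sin_n0 (m n : int) : (m, n) <> (0, 0) ->
    sin (2 * pi * (m%:~R * theta a + n%:~R * theta b)) != 0.
  move=> mn; have [c [L [c0 H]]] := diophantine_sin dab.
  have := H (`|m| + `|n|).+1%N m n isT; rewrite -normr_gt0; set B := (_ + _).+1.
  move=> h; apply: lt_le_trans (h _ _ mn); first by rewrite divr_gt0 ?exprn_gt0 ?ltr0n.
  - by rewrite /B ltnW// ltnS leq_addr.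
  - by rewrite /B ltnW// ltnS leq_addl.
have ab : a != b.
  apply/eqP => e; have /eqP := sin_n0 1 (-1) ltac:(by []); apply.
  by rewrite e mulrNz !mul1r mulN1r subrr mulr0 sin0.
have im1 : im (lam a * lam b) != 0.
  have := sin_n0 1 1 ltac:(by []); rewrite !mul1r => h.
  have -> : lam a * lam b = ((Defs.ratio Phi a * Defs.ratio Phi b)%:C)%C * expi (theta a + theta b).
    by rewrite /lam /multiplier expiD rmorphM /=; ring.
  by rewrite im_realM !mulf_neq0.
have im2 : im (lam a * ((lam b)^*)%C) != 0.
  have := sin_n0 1 (-1) ltac:(by []); rewrite mulrNz mul1r mulN1r => h.
  have -> : lam a * ((lam b)^*)%C =
      ((Defs.ratio Phi a * Defs.ratio Phi b)%:C)%C * expi (theta a + - theta b).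
    have -> : ((lam b)^*)%C = ((Defs.ratio Phi b)%:C)%C * ((expi (theta b))^*)%C.
      by rewrite -[in RHS]conjc_real; exact: rmorphM.
    by rewrite /lam /multiplier expiD -expiJ [in RHS]rmorphM /=; ring.
  by rewrite im_realM !mulf_neq0.
have nofix : ~ (exists z, forall c, lam c * z + t c = z).
  move=> [z hz]; apply: (no_common_fixed_point (s := Phi)).
  exists (re z, im z) => c.
  have := cplx_ifs_map (re z, im z) (htheta c).
  have -> : cplx (re z, im z) = z by case: (z).
  rewrite -/(lam c) -/(t c) hz /ifs_map /cplx.
  by case: (affine_map _ _ _ _) => u v /= <-.
have [x [y [dxy imxy]]] := exists_swap_pair l1 ln0 nofix im1 im2.
have xy : x != y by apply: contra dxy => /eqP ->; rewrite subrr.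
have fl := swap_flat p0 p1 FE F1 r00 r11 lr xy dxy imxy.
(* One of the distinct letters [a] and [b] differs from [c] and has positive weight. *)
have plt c : p c < 1.
  have [c' cc'] : exists c', c' != c.
    by have [e|e] := eqVneq a c; [exists b; rewrite -e eq_sym | exists a].
  rewrite -p1 (bigD1 c)//= ltrDl (bigD1 c')//= ltr_wpDr// sumr_ge0// => e _.
  exact: ltW.
have sm := self_similar_submean p0 FE.
have F01 z : 0 <= normc (F z) <= 1 by rewrite normc_ge0 F1.
have sep := diophantine_separated (rn0 a) (rn0 b) dab.
have [K [D [tau [K0 D1 tau0 tau1 H]]]] :=
  flat_decay p0 p1 (plt a) (plt b) r00 r11 lr sm F01 sep fl.
have [kappa k0 [C HC]] := polylog_of_tower K0 D1 tau0 tau1.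
exists kappa => //; exists C, D => xi Dxi.
pose z : R[i] := Complex xi.1 (- xi.2).
have zxi : frequency z = xi by rewrite /frequency /= opprK; case: (xi).
have nz : normc z = enorm xi by rewrite /z /enorm /dotp /= sqrrN -!expr2.
have := HC (enorm xi) (normc (F z)) Dxi.
rewrite /F /fourierc zxi; apply => u hu.
by have := H u z; rewrite nz => /(_ hu); rewrite /F /fourierc zxi.
Qed.
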